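(* Let $k\ge2$, let $\mathbb{K}$ be a field, and let $I_1,\ldots,I_k$ be nonzero proper homogeneous ideals in the polynomial rings $\mathbb{K}[x_{1,1},\ldots,x_{1,m_1}],\ldots,\mathbb{K}[x_{k,1},\ldots,x_{k,m_k}]$, respectively (in pairwise disjoint sets of variables). For $1\le i\le k$, let $p_i$ be the least positive integer such that $I_i^{(p_i)}\ne I_i^{p_i}$ (assumed to exist). Assume that $p_1\le\cdots\le p_k$. If $\rho(I_i)=1$ for all $1\le i\le k$, then $$\rho(I_1+\cdots+I_k)=\max\Big\{\frac{p_1+\cdots+p_r}{p_1+\cdots+p_r-r+1} : 2\le r\le k\Big\}.$$
   Context: $I_1+\cdots+I_k$ denotes the ideal generated by $I_1,\ldots,I_k$ in the polynomial ring $\mathbb{K}[x_{1,1},\ldots,x_{1,m_1},\ldots,x_{k,1},\ldots,x_{k,m_k}]$. For an ideal $I$ in a Noetherian ring $R$, $I^{(s)}=\bigcap_{P\in\mathrm{Ass}(I)}(I^sR_P\cap R)$ is the $s$-th symbolic power. The resurgence is $\rho(I)=\sup\{s/t : s,t\in\mathbb{N},\ I^{(s)}\not\subset I^t\}$, where $\mathbb{N}$ denotes the positive integers. *)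

(* Defs.v *)
From HB Require Import structures.
From mathcomp Require Import all_boot all_order all_algebra.
(* mpoly has to be imported before classical_sets: the other order is
   rejected because of incompatible notation levels. *)
From mathcomp Require Import fraction mpoly.
From mathcomp Require Import boolp classical_sets reals constructive_ereal ereal.

Set Implicit Arguments.
Unset Strict Implicit.
Unset Printing Implicit Defensive.

Import Order.TTheory GRing.Theory Num.Theory.

Local Open Scope classical_set_scope.
Local Open Scope ring_scope.

(* Ideals are Prop-valued sets, as nothing makes membership decidable.
   The ambient subring L is setT for ideals of A itself; it is a localization
   when A is a field of fractions. *)
Definition ideal_of (A : comNzRingType) (L M : set A) : Prop :=
  [/\ M `<=` L,
      M 0,
      forall x y, M x -> M y -> M (x + y)
    & forall c x, L c -> M x -> M (c * x)].

Definition is_ideal (A : comNzRingType) (I : set A) : Prop := ideal_of setT I.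

Definition ideal_gen (A : comNzRingType) (L S : set A) : set A :=
  smallest (ideal_of L) S.

Definition prime_ideal (A : comNzRingType) (P : set A) : Prop :=
  [/\ is_ideal P, ~ P 1 & forall x y, P (x * y) -> P x \/ P y].

Definition ideal_pow (A : comNzRingType) (I : set A) (s : nat) : set A :=
  ideal_gen setT
    [set x | exists f : 'I_s -> A, (forall i, I (f i)) /\ x = \prod_(i < s) f i].

(* Ass(I) = Ass(A / I): the primes that are the annihilator of a class x + I. *)
Definition Ass (A : comNzRingType) (I : set A) : set (set A) :=
  [set P | prime_ideal P /\ exists x, P = [set a | I (a * x)]].

(* The localization A_P, inside the field of fractions of the domain A. *)
Definition localization (A : idomainType) (P : set A) : set {fraction A} :=
  [set z | exists a u, ~ P u /\ z = tofrac a / tofrac u].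

(* J A_P, an ideal of A_P. *)
Definition ideal_ext (A : idomainType) (P J : set A) : set {fraction A} :=
  ideal_gen (localization P) ((@tofrac A) @` J).

Definition symbolic_pow (A : idomainType) (I : set A) (s : nat) : set A :=
  \bigcap_(P in Ass I) ((@tofrac A) @^-1` ideal_ext P (ideal_pow I s)).

Definition resurgence (R : realType) (A : idomainType) (I : set A) : \bar R :=
  ereal_sup [set q | exists s t : nat,
    [/\ (0 < s)%N, (0 < t)%N,
        ~ symbolic_pow I s `<=` ideal_pow I t
      & q = (s%:R / t%:R)%:E]].

Definition first_symbolic_gap (A : idomainType) (I : set A) (p : nat) : Prop :=
  [/\ (0 < p)%N,
      symbolic_pow I p <> ideal_pow I p
    & forall q, (0 < q < p)%N -> symbolic_pow I q = ideal_pow I q].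

Definition homogeneous_ideal (K : fieldType) (n : nat) (I : set {mpoly K[n]}) :
    Prop :=
  exists S : set {mpoly K[n]},
    (forall f, S f -> exists d, f \is d.-homog) /\ I = ideal_gen setT S.

(* The blocks of variables x_{i,1}, ..., x_{i,m_i} are laid out one after the
   other in 'I_(\sum_i m i); tagnat.Rank i j is the position of x_{i,j}. *)
Definition block_embed (K : fieldType) (k : nat) (m : 'I_k -> nat) (i : 'I_k)
    (f : {mpoly K[m i]}) : {mpoly K[\sum_(i < k) m i]} :=
  f \mPo [tuple 'X_(tagnat.Rank i j) | j < m i].

Definition ideal_sum (K : fieldType) (k : nat) (m : 'I_k -> nat)
    (I : forall i : 'I_k, set {mpoly K[m i]}) :
    set {mpoly K[\sum_(i < k) m i]} :=
  ideal_gen setT (\bigcup_i (@block_embed K k m i @` I i)).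

(* Main.v *)
Require Import Defs.
From HB Require Import structures.
From mathcomp Require Import all_boot all_order all_algebra.
From mathcomp.multinomials Require Import ssrcomplements.
From mathcomp Require Import fraction mpoly.
From mathcomp Require Import boolp classical_sets reals constructive_ereal ereal.

Set Implicit Arguments.
Unset Strict Implicit.
Unset Printing Implicit Defensive.

Import Order.TTheory GRing.Theory Num.Theory.

Local Open Scope classical_set_scope.
Local Open Scope ring_scope.

(** Let [A] be the polynomial ring in all variables and [I] the sum of the
    [I i], extended to [A].  As [A] is a tensor product over the field, it is
    free over the polynomial ring of each block, even modulo an ideal that comes
    from the other blocks; [block_framed] gives this freeness in the form of
    finite dual systems of linear forms.  Four facts follow.

    - An element is in [I ^ t] exactly when it is in the sum of the [I i ^ a i]
      for all positive [a] with [\sum_i (a i - 1) < t].  One direction is the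
      pigeonhole principle ([pow_idsum_sub]), the other is flatness
      ([pow_idsum_cap]).
    - The symbolic power of [I] of exponent [s] is contained in the sum of the
      symbolic powers of the [I i] of exponents [b i], if
      [\sum_i (b i - 1) < s] ([symbolic_pow_idsum_sub]).
    - A product of elements of symbolic powers of the [I i] is in the symbolic
      power of [I] for the sum of the exponents ([prod_mem_symbolic_pow]).
    - A product of elements [f i] outside the ideals [F i] of the blocks is
      outside the sum of the [F i] ([prod_notin_idsum]).

    The second fact is the hard one.  If [f] avoids the sum of the symbolic
    powers, let [N] be the module that the coordinates of [f] with respect to
    block [i] generate modulo the symbolic power of [I i].  The annihilator of
    [N] lies in an associated prime [P] of [I i], so [N] has a nonzero linear map
    to the quotient by [P] ([specialization]), which embeds in the quotient by
    [I i].  Applied to the coordinates of [f], it gives a nonzero element modulo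
    an ideal in which [I i] has replaced its symbolic power, and everything that
    kills [f] kills this element too.  After all blocks, the multipliers of [f]
    into [I ^ s] kill a nonzero class modulo [I]; as [A] is noetherian, they lie
    in an associated prime of [I], and [f] is not in the symbolic power.

    For the upper bound, suppose that the symbolic power of exponent [s] is not
    contained in [I ^ t].  By the first two facts there are [a i] such that the
    bounds [b i] needed to enter [I i ^ a i] satisfy [s <= \sum_i (b i - 1)].
    Resurgence 1 gives [b i <= a i + 1], and [b i = a i] if [a i < p i].  If [B]
    is the set of the blocks with [p i <= a i], of cardinality [r], then
    [s <= t - 1 + r] and [\sum_(i in B) (p i - 1) <= t - 1]; since [p] is sorted,
    [s / t] is at most the term of index [r], or at most 1 if [r <= 1]; all
    terms are at least 1.

    For the lower bound, multiply elements of the symbolic powers of exponents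
    [p i] outside [I i ^ p i] for the first [r] blocks: the last two facts and
    the pigeonhole principle show that the term of index [r] is a ratio [s / t]
    with non-containment. *)

(** * Arithmetic of ideals *)

Section IdealArithmetic.
Variable A : comNzRingType.
Implicit Types (F G S : set A) (x y a b : A) (n : nat).

Definition idadd F G : set A :=
  [set x | exists a b, [/\ F a, G b & x = a + b]].

Definition idmul F G : set A :=
  ideal_gen setT [set x | exists a b, [/\ F a, G b & x = a * b]].

Definition idsum (k : nat) (F : 'I_k -> set A) : set A :=
  ideal_gen setT (\bigcup_i F i).

Lemma ideal0 F : is_ideal F -> F 0.
Proof. by case. Qed.

Lemma idealD F x y : is_ideal F -> F x -> F y -> F (x + y).
Proof. by case=> _ _ + _; apply. Qed.

Lemma idealMl F c x : is_ideal F -> F x -> F (c * x).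
Proof. by case=> _ _ _; apply. Qed.

Lemma idealMr F c x : is_ideal F -> F x -> F (x * c).
Proof. by rewrite mulrC; apply: idealMl. Qed.

Lemma idealN F x : is_ideal F -> F x -> F (- x).
Proof. by rewrite -mulN1r; apply: idealMl. Qed.

Lemma idealB F x y : is_ideal F -> F x -> F y -> F (x - y).
Proof. by move=> idF Fx Fy; apply: idealD => //; apply: idealN. Qed.

Lemma ideal_sumr (T : Type) (r : seq T) (P : pred T) (f : T -> A) F :
  is_ideal F -> (forall t, P t -> F (f t)) -> F (\sum_(t <- r | P t) f t).
Proof.
move=> idF Ff; apply: big_rec => [|t x /Ff Ft Fx]; first exact: ideal0.
exact: idealD.
Qed.

Lemma ideal_eqT F : is_ideal F -> F 1 -> F = setT.
Proof.
by move=> idF F1; apply/seteqP; split=> // x _; rewrite -(mulr1 x); apply: idealMl.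
Qed.

Lemma ideal_zero : is_ideal [set 0 : A].
Proof.
by split=> // [x y -> ->|c x _ ->] /=; rewrite ?addr0 ?mulr0.
Qed.

Lemma ideal_gen_ideal S : is_ideal (ideal_gen setT S).
Proof.
split=> // [M [idM _]|x y Sx Sy M MS|c x _ Sx M MS]; first exact: ideal0.
  by have [idM _] := MS; apply: idealD => //; [apply: Sx|apply: Sy].
by have [idM _] := MS; apply: idealMl => //; apply: Sx.
Qed.

Lemma ideal_gen_sub S F : is_ideal F -> S `<=` F -> ideal_gen setT S `<=` F.
Proof. exact: smallest_sub. Qed.

Lemma sub_ideal_gen S : S `<=` ideal_gen setT S.
Proof. exact: sub_gen_smallest. Qed.

Lemma ideal_genS S S' : S `<=` S' -> ideal_gen setT S `<=` ideal_gen setT S'.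
Proof.
move=> SS'; apply: ideal_gen_sub; first exact: ideal_gen_ideal.
by move=> x /SS'; apply: sub_ideal_gen.
Qed.

Lemma idadd_ideal F G : is_ideal F -> is_ideal G -> is_ideal (idadd F G).
Proof.
move=> idF idG; split=> //.
- by exists 0, 0; rewrite addr0; split=> //; apply: ideal0.
- move=> _ _ [a [b [Fa Gb ->]]] [c [d [Fc Gd ->]]].
  by exists (a + c), (b + d); rewrite addrACA; split=> //; apply: idealD.
- move=> c _ _ [a [b [Fa Gb ->]]]; exists (c * a), (c * b).
  by rewrite mulrDr; split=> //; apply: idealMl.
Qed.

Lemma sub_idaddl F G : is_ideal G -> F `<=` idadd F G.
Proof. by move=> idG x Fx; exists x, 0; rewrite addr0; split=> //; apply: ideal0. Qed.

Lemma sub_idaddr F G : is_ideal F -> G `<=` idadd F G.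
Proof. by move=> idF x Gx; exists 0, x; rewrite add0r; split=> //; apply: ideal0. Qed.

Lemma idadd_sub F G H : is_ideal H -> F `<=` H -> G `<=` H -> idadd F G `<=` H.
Proof.
by move=> idH FH GH _ [a [b [/FH Ha /GH Hb ->]]]; apply: idealD.
Qed.

Lemma idaddS F F' G G' : F `<=` F' -> G `<=` G' -> idadd F G `<=` idadd F' G'.
Proof. by move=> FF GG _ [a [b [/FF ? /GG ? ->]]]; exists a, b. Qed.

Lemma idmul_ideal F G : is_ideal (idmul F G).
Proof. exact: ideal_gen_ideal. Qed.

Lemma mem_idmul F G a b : F a -> G b -> idmul F G (a * b).
Proof. by move=> Fa Gb; apply: sub_ideal_gen; exists a, b. Qed.

Lemma idmul_sub F G H : is_ideal H ->
  (forall a b, F a -> G b -> H (a * b)) -> idmul F G `<=` H.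
Proof.
by move=> idH FGH; apply: ideal_gen_sub => // _ [a [b [Fa Gb ->]]]; apply: FGH.
Qed.

Lemma idmul_subr F G : is_ideal G -> idmul F G `<=` G.
Proof. by move=> idG; apply: idmul_sub => // a b _; apply: idealMl. Qed.

Lemma idmul_subl F G : is_ideal F -> idmul F G `<=` F.
Proof. by move=> idF; apply: idmul_sub => // a b Fa _; apply: idealMr. Qed.

Lemma ideal_colon F x : is_ideal F -> is_ideal [set y | F (x * y)].
Proof.
move=> idF; split=> //= [|y z Fy Fz|c y _ Fy]; first by rewrite mulr0; apply: ideal0.
  by rewrite mulrDr; apply: idealD.
by rewrite mulrCA; apply: idealMl.
Qed.

Lemma ideal_gen_mul S S' F x y : is_ideal F ->
  (forall a b, S a -> S' b -> F (a * b)) ->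
  ideal_gen setT S x -> ideal_gen setT S' y -> F (x * y).
Proof.
move=> idF SS' Sx Sy.
have {}SS' a : S a -> F (a * y).
  move=> Sa; apply: (ideal_gen_sub (ideal_colon a idF)) Sy => b.
  exact: SS'.
rewrite mulrC; apply: (ideal_gen_sub (ideal_colon y idF)) Sx => a /=.
by rewrite mulrC; apply: SS'.
Qed.

Lemma ideal_pow_ideal F n : is_ideal (ideal_pow F n).
Proof. exact: ideal_gen_ideal. Qed.

Lemma ideal_pow0 F : ideal_pow F 0 = setT.
Proof.
apply: ideal_eqT; first exact: ideal_pow_ideal.
by apply: sub_ideal_gen; exists (fun=> 1); split=> [[]//|]; rewrite big_ord0.
Qed.

Lemma ideal_powS F n : ideal_pow F n.+1 = idmul F (ideal_pow F n).
Proof.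
apply/seteqP; split.
  apply: ideal_gen_sub; first exact: idmul_ideal.
  move=> _ [f [Ff ->]]; rewrite big_ord_recl; apply: mem_idmul => //.
  by apply: sub_ideal_gen; exists (fun i => f (lift ord0 i)).
apply: idmul_sub; first exact: ideal_pow_ideal.
move=> a b Fa; have idC := ideal_colon a (ideal_pow_ideal F n.+1).
move: b; apply: (ideal_gen_sub idC).
move=> _ [f [Ff ->]]; apply: sub_ideal_gen.
exists (fun i => oapp f a (unlift ord0 i)); split.
  by move=> i; case: (unlift ord0 i) => [j|] /=.
rewrite big_ord_recl unlift_none /=; congr (_ * _).
by apply: eq_bigr => i _; rewrite liftK.
Qed.

Lemma ideal_pow1 F : is_ideal F -> ideal_pow F 1 = F.
Proof.
move=> idF; rewrite ideal_powS ideal_pow0; apply/seteqP; split.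
  exact: idmul_subl.
by move=> x Fx; rewrite -(mulr1 x); apply: mem_idmul.
Qed.

Lemma ideal_pow_mul F (a b : nat) x y :
  ideal_pow F a x -> ideal_pow F b y -> ideal_pow F (a + b) (x * y).
Proof.
elim: a x y => [|a IH] x y.
  by move=> _; apply: idealMl; apply: ideal_pow_ideal.
rewrite addSn !ideal_powS => xF Fy; apply: (ideal_gen_mul _ _ xF (sub_ideal_gen Fy)).
  exact: idmul_ideal.
move=> _ {Fy}z [c [d [Fc Fd ->]]] Fz; rewrite -mulrA; apply: mem_idmul => //.
exact: IH.
Qed.

Lemma ideal_pow_monotone F G n : F `<=` G -> ideal_pow F n `<=` ideal_pow G n.
Proof.
by move=> FG; apply: ideal_genS => _ [f [Ff ->]]; exists f; split=> // i; apply: FG.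
Qed.

Lemma ideal_pow_antitone F n n' :
  (n' <= n)%N -> ideal_pow F n `<=` ideal_pow F n'.
Proof.
move=> /subnK <-; elim: (n - n')%N => [|d IH] //.
rewrite addSn ideal_powS; apply: subset_trans IH.
by apply: idmul_subr; apply: ideal_pow_ideal.
Qed.

(** Pigeonhole: a product of [n] elements of [F + G] expands into terms that
    have [a] factors from [F] or [b] factors from [G]. *)
Lemma ideal_pow_add_sub F G (a b : nat) n : is_ideal F -> is_ideal G ->
  (a + b <= n.+1)%N ->
  ideal_pow (idadd F G) n `<=` idadd (ideal_pow F a) (ideal_pow G b).
Proof.
move=> idF idG.
have idS (c d : nat) : is_ideal (idadd (ideal_pow F c) (ideal_pow G d)).
  by apply: idadd_ideal; apply: ideal_pow_ideal.
case: a => [|a].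
  rewrite ideal_pow0 => _ x _; apply: sub_idaddl => //; exact: ideal_pow_ideal.
case: b => [|b].
  rewrite ideal_pow0 => _ x _; apply: sub_idaddr => //; exact: ideal_pow_ideal.
elim: n a b => [|n IH] a b; first by rewrite addSn addnS.
move=> abn; rewrite ideal_powS; apply: idmul_sub => // _ z [x [y [Fx Gy ->]]] zn.
rewrite mulrDl; apply: idealD => //.
  have [u [v [Fu Gv ->]]] : idadd (ideal_pow F a) (ideal_pow G b.+1) z.
    case: a abn => [|a] abn; last by apply: IH => //; rewrite addSn ltnS in abn.
    rewrite ideal_pow0; apply: sub_idaddl => //; exact: ideal_pow_ideal.
  rewrite mulrDr; exists (x * u), (x * v); split=> //.
    by rewrite ideal_powS; apply: mem_idmul.
  exact: (idealMl x (ideal_pow_ideal _ _) Gv).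
have [u [v [Fu Gv ->]]] : idadd (ideal_pow F a.+1) (ideal_pow G b) z.
  case: b abn => [|b] abn.
    rewrite ideal_pow0; apply: sub_idaddr => //; exact: ideal_pow_ideal.
  by apply: IH => //; rewrite addnS ltnS in abn.
rewrite mulrDr; exists (y * u), (y * v); split=> //.
  exact: (idealMl y (ideal_pow_ideal _ _) Fu).
by rewrite ideal_powS; apply: mem_idmul.
Qed.

Section FiniteSums.
Variable k : nat.
Implicit Types (E : 'I_k -> set A) (i j : 'I_k).

Definition others E i : 'I_k -> set A :=
  fun j => if j == i then [set 0] else E j.

Lemma idsum_ideal E : is_ideal (idsum E).
Proof. exact: ideal_gen_ideal. Qed.

Lemma sub_idsum E i : E i `<=` idsum E.
Proof. by move=> x Ex; apply: sub_ideal_gen; exists i. Qed.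

Lemma idsum_sub E H : is_ideal H -> (forall i, E i `<=` H) -> idsum E `<=` H.
Proof. by move=> idH EH; apply: ideal_gen_sub => // x [i _ /EH]. Qed.

Lemma idsumS E E' : (forall i, E i `<=` E' i) -> idsum E `<=` idsum E'.
Proof. by move=> EE'; apply: ideal_genS => x [i _ /EE' ?]; exists i. Qed.

Lemma idsum_split E i : is_ideal (E i) -> idsum E = idadd (E i) (idsum (others E i)).
Proof.
move=> idE; have idO := idsum_ideal (others E i); apply/seteqP; split.
  apply: idsum_sub => [|j]; first exact: idadd_ideal.
  have [->|ji] := eqVneq j i; first exact: sub_idaddl.
  apply: subset_trans (sub_idaddr idE).
  by apply: subset_trans (@sub_idsum _ j); rewrite /others (negbTE ji).
apply: idadd_sub; [exact: idsum_ideal|exact: sub_idsum|].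
apply: idsum_sub => [|j]; first exact: idsum_ideal.
rewrite /others; case: eqP => _; last exact: sub_idsum.
by move=> _ ->; apply: ideal0; apply: idsum_ideal.
Qed.

Lemma idsum_zero E : (forall i, E i = [set 0]) -> idsum E = [set 0].
Proof.
move=> E0; apply/seteqP; split.
  by apply: idsum_sub => [|i]; [exact: ideal_zero|rewrite E0].
by move=> _ ->; apply: ideal0; apply: idsum_ideal.
Qed.

End FiniteSums.
End IdealArithmetic.

Section Extension.
Variables (R A : comNzRingType) (f : {rmorphism R -> A}).
Implicit Types (F G : set R).

Definition idext F : set A := ideal_gen setT (f @` F).

Lemma idext_ideal F : is_ideal (idext F).
Proof. exact: ideal_gen_ideal. Qed.

Lemma mem_idext F a : F a -> idext F (f a).
Proof. by move=> Fa; apply: sub_ideal_gen; exists a. Qed.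

Lemma idext_sub F H : is_ideal H -> (forall a, F a -> H (f a)) -> idext F `<=` H.
Proof. by move=> idH FH; apply: ideal_gen_sub => // _ [a Fa <-]; apply: FH. Qed.

Lemma idextS F G : F `<=` G -> idext F `<=` idext G.
Proof. by move=> FG; apply: ideal_genS => _ [a /FG ? <-]; exists a. Qed.

Lemma idext_pow F n : idext (ideal_pow F n) = ideal_pow (idext F) n.
Proof.
apply/seteqP; split.
  apply: idext_sub => [|a]; first exact: ideal_pow_ideal.
  elim: n a => [|n IH] a; first by rewrite !ideal_pow0.
  rewrite !ideal_powS => Fa.
  have idM := idmul_ideal (idext F) (ideal_pow (idext F) n).
  have idH : is_ideal [set b | idmul (idext F) (ideal_pow (idext F) n) (f b)].
    split=> //= [|x y|c x _]; rewrite ?rmorph0 ?rmorphD ?rmorphM.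
    - exact: ideal0.
    - exact: idealD.
    - exact: idealMl.
  apply: (idmul_sub idH _ Fa) => x y Fx Fy /=; rewrite rmorphM.
  by apply: mem_idmul; [apply: mem_idext|apply: IH].
elim: n => [|n IH] x.
  move=> _; rewrite -(mulr1 x); apply: (idealMl x (idext_ideal _)).
  by rewrite -(rmorph1 f); apply: mem_idext; rewrite ideal_pow0.
rewrite !ideal_powS; apply: idmul_sub x; first exact: idext_ideal.
move=> x y Fx /IH Fy; apply: (ideal_gen_mul _ _ Fx Fy); first exact: idext_ideal.
move=> _ _ [a Fa <-] [b Fb <-]; rewrite -rmorphM; apply: mem_idext.
exact: mem_idmul.
Qed.

End Extension.

(** * Symbolic powers without fractions *)

Section SymbolicPower.
Variable A : idomainType.
Implicit Types (P J I : set A) (a u : A).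

Lemma prime_ideal_neq0 P u : prime_ideal P -> ~ P u -> tofrac u != 0.
Proof.
move=> [idP _ _] Pu; rewrite tofrac_eq0; apply: contra_notN Pu => /eqP ->.
exact: ideal0.
Qed.

Lemma prime_idealM P u v : prime_ideal P -> ~ P u -> ~ P v -> ~ P (u * v).
Proof. by move=> [_ _ prP] Pu Pv /prP[]. Qed.

(** As [P] is prime, the fractions with numerator in [J] and denominator
    outside [P] already form an ideal of the localization. *)
Lemma ideal_extP P J a : prime_ideal P -> is_ideal J ->
  ideal_ext P J (tofrac a) <-> exists u, ~ P u /\ J (u * a).
Proof.
move=> prP idJ; split; last first.
  move=> [u [Pu Jua]] M [[_ _ _ MM] JM].
  have u0 := prime_ideal_neq0 prP Pu.
  rewrite -(mulKf u0 (tofrac a)) -rmorphM; apply: MM; last by apply: JM; exists (u * a).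
  by exists 1, u; rewrite rmorph1 div1r.
pose M := [set z : {fraction A} | exists b u, [/\ J b, ~ P u & z = tofrac b / tofrac u]].
have idM : ideal_of (localization P) M.
  have [_ P1 _] := prP; split.
  - by move=> _ [b [u [_ Pu ->]]]; exists b, u.
  - by exists 0, 1; rewrite rmorph0 mul0r; split=> //; apply: ideal0.
  - move=> _ _ [b [u [Jb Pu ->]]] [c [v [Jc Pv ->]]].
    exists (b * v + c * u), (u * v); split.
    + by apply: idealD => //; apply: idealMr.
    + exact: prime_idealM.
    + by rewrite addf_div ?(prime_ideal_neq0 prP) // !rmorphD !rmorphM.
  - move=> _ _ [c [v [Pv ->]]] [b [u [Jb Pu ->]]].
    exists (c * b), (v * u); split; [exact: idealMl|exact: prime_idealM|].
    by rewrite mulf_div !rmorphM.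
have JM : (@tofrac A) @` J `<=` M.
  by have [_ P1 _] := prP; move=> _ [b Jb <-]; exists b, 1; rewrite rmorph1 divr1.
move=> /(_ M (conj idM JM)) [b [u [Jb Pu /eqP]]].
rewrite eq_sym -[_ == _](inj_eq (mulIf (prime_ideal_neq0 prP Pu))).
rewrite divfK ?(prime_ideal_neq0 prP) // -rmorphM tofrac_eq => /eqP bE.
by exists u; rewrite mulrC -bE.
Qed.

Lemma Ass_prime I P : Ass I P -> prime_ideal P.
Proof. by case. Qed.

Lemma symbolic_powP I s a :
  symbolic_pow I s a <->
  forall P, Ass I P -> exists u, ~ P u /\ ideal_pow I s (u * a).
Proof.
split=> Ia P AP.
  by apply/(ideal_extP _ (Ass_prime AP) (ideal_pow_ideal I s)); apply: Ia.
by apply/(ideal_extP _ (Ass_prime AP) (ideal_pow_ideal I s)); apply: Ia.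
Qed.

Lemma symbolic_pow_ideal I s : is_ideal (symbolic_pow I s).
Proof.
have idp := ideal_pow_ideal I s; split=> //.
- apply/symbolic_powP => P /Ass_prime[_ P1 _].
  by exists 1; rewrite mulr0; split=> //; apply: ideal0.
- move=> x y /symbolic_powP Ix /symbolic_powP Iy.
  apply/symbolic_powP => P AP; have [u [Pu Iux]] := Ix P AP.
  have [v [Pv Ivy]] := Iy P AP; exists (u * v); split.
    exact: prime_idealM (Ass_prime AP) Pu Pv.
  rewrite mulrDr; apply: (idealD idp).
    by rewrite mulrAC; apply: (idealMr v idp).
  by rewrite -mulrA; apply: (idealMl u idp).
- move=> c x _ /symbolic_powP Ix; apply/symbolic_powP => P AP.
  have [u [Pu Iux]] := Ix P AP; exists u; split=> //.
  by rewrite mulrCA; apply: (idealMl c idp).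
Qed.

Lemma ideal_pow_sub_symbolic I s : ideal_pow I s `<=` symbolic_pow I s.
Proof.
move=> x Ix; apply/symbolic_powP => P /Ass_prime[_ P1 _].
by exists 1; rewrite mul1r.
Qed.

End SymbolicPower.

(** * Associated primes in polynomial rings *)

Definition noetherian (A : comNzRingType) : Prop :=
  forall C : set (set A), (forall F, C F -> is_ideal F) -> C !=set0 ->
    exists F, C F /\ forall G, C G -> F `<=` G -> G `<=` F.

(** A minimum of [g] beyond each index; following these minima upwards gives
    the subsequence. *)
Lemma nondecreasing_subsequence (g : nat -> nat) :
  exists s : nat -> nat, (forall i, s i < s i.+1)%N /\
    forall i j, (i <= j)%N -> (g (s i) <= g (s j))%N.
Proof.
have argmin N : exists i, (N <= i)%N /\ forall j, (N <= j)%N -> (g i <= g j)%N.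
  have exv : exists v, `[< exists i, (N <= i)%N /\ g i = v >].
    by exists (g N); apply/asboolP; exists N.
  case: (ex_minnP exv) => v /asboolP[i [Ni <-]] min_v.
  by exists i; split=> // j Nj; apply: min_v; apply/asboolP; exists j.
have [f fP] := choice argmin.
exists (fun i => iter i (fun N => f N.+1) (f 0%N)); split=> [i|i j].
  by rewrite iterS; have [] := fP (iter i (fun N => f N.+1) (f 0%N)).+1.
move=> /subnK <-; elim: (j - i)%N => [|d IH] //.
apply: leq_trans IH _; rewrite addSn iterS; set N := iter _ _ _.
have Nf : (N <= f N.+1)%N by apply: ltnW; have [] := fP N.+1.
suff [M NE MN] : exists2 M, N = f M & (M <= N)%N.
  by rewrite {1}NE; have [_] := fP M; apply; apply: leq_trans Nf.
rewrite {Nf}/N; case: (d + i)%N => [|e]; first by exists 0%N.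
by eexists; [rewrite iterS|rewrite iterS; have [] := fP (iter e (fun N => f N.+1) (f 0%N)).+1].
Qed.

(** Dickson's lemma: pass to subsequences that are nondecreasing in one more
    coordinate each time. *)
Lemma dickson n (g : nat -> 'X_{1..n}) : exists i j, (i < j)%N /\ (g i <= g j)%MM.
Proof.
suff sub d : (d <= n)%N -> exists s : nat -> nat, (forall i, s i < s i.+1)%N /\
    forall (l : 'I_n) i j, (l < d)%N -> (i <= j)%N -> (g (s i) l <= g (s j) l)%N.
  have [s [s_inc sP]] := sub n (leqnn n).
  by exists (s 0%N), (s 1%N); split=> //; apply/mnm_lepP => l; apply: sP.
have incP (s : nat -> nat) : (forall i, s i < s i.+1)%N ->
    forall i j, (i <= j)%N -> (s i <= s j)%N.
  move=> s_inc i j /subnK <-; elim: (j - i)%N => [|e IH] //.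
  by apply: leq_trans IH _; rewrite addSn ltnW.
have incS (s : nat -> nat) : (forall i, s i < s i.+1)%N ->
    forall i j, (i < j)%N -> (s i < s j)%N.
  by move=> s_inc i j ij; apply: leq_trans (incP s s_inc _ _ ij).
elim: d => [|d IH] dn; first by exists id.
have [s [s_inc sP]] := IH (ltnW dn).
have [s' [s'_inc s'P]] := nondecreasing_subsequence (fun i => g (s i) (Ordinal dn)).
exists (s \o s'); split=> [i|l i j] /=; first exact: incS.
rewrite ltnS leq_eqVlt => /predU1P[ld|ld] ij.
  by rewrite (_ : l = Ordinal dn); [apply: s'P|apply: val_inj].
by apply: sP => //; apply: incP.
Qed.

(** Two ideals [J <= J'] with the same leading monomials are equal, so along a
    strictly increasing chain the minimal leading monomials of the successive
    differences would contradict Dickson's lemma. *)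
Theorem mpoly_noetherian (K : fieldType) n : noetherian {mpoly K[n]}.
Proof.
move=> C idC [F0 CF0]; apply: contrapT => nomax.
have up F : exists G, C F -> [/\ C G, F `<=` G & exists g, G g /\ ~ F g].
  have [CF|nCF] := pselect (C F); last by exists F.
  apply: contrapT => noG; apply: nomax; exists F; split=> // G CG FG g Gg.
  apply: contrapT => nFg; apply: noG; exists G => _; split=> //; by exists g.
have [next nextP] := choice up.
pose J i := iter i next F0.
have CJ i : C (J i) by elim: i => // i IH; have [] := nextP _ IH.
have JS i : J i `<=` J i.+1 by have [] := nextP _ (CJ i).
have JM i j : (i <= j)%N -> J i `<=` J j.
  move=> /subnK <-; elim: (j - i)%N => // d IH.
  exact: subset_trans IH (JS _).
have lowest i : exists g, [/\ J i.+1 g, ~ J i g &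
    forall h, J i.+1 h -> ~ J i h -> ~ (mlead h < mlead g)%O].
  have [_ _ [g [Jg nJg]]] := nextP _ (CJ i).
  elim/(@mleadrect n K): g Jg nJg => g IH Jg nJg.
  apply: contrapT => nog; apply: (nog); exists g; split=> // h Jh nJh hg.
  by have [g' g'P] := IH h hg Jh nJh; apply: nog; exists g'.
have [g gP] := choice lowest.
have [i [j [ij le_ij]]] := dickson (fun i => mlead (g i)).
have [Jgi nJgi _] := gP i; have [Jgj nJgj min_gj] := gP j.
have idJ l := idC _ (CJ l).
have g0 l : g l != 0.
  by apply/eqP => gl0; have [_ + _] := gP l; rewrite gl0; apply; apply: ideal0.
set a := mlead (g i) in le_ij *; set b := mlead (g j) in le_ij *.
pose c := (g j)@_b / (g i)@_a.
have gia0 : (g i)@_a != 0 by rewrite mleadc_eq0.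
have gjb0 : (g j)@_b != 0 by rewrite mleadc_eq0.
pose q : {mpoly K[n]} := (c *: 'X_[b - a]) * g i.
have Jq : J j q by apply: idealMl => //; apply: (JM _ _ ij).
have nJh : ~ J j (g j - q).
  by move=> Jh; apply: nJgj; rewrite -(subrK q (g j)); apply: idealD.
apply: (min_gj (g j - q)) => //; first by apply: idealB => //; apply: JS.
have c0 : c != 0 by rewrite mulf_neq0 ?invr_eq0.
have leadX : mlead (c *: 'X_[K, (b - a)%MM]) = (b - a)%MM by rewrite mleadZ // mleadXm.
have leadq : mlead q = b.
  by rewrite /q mleadM ?g0 ?leadX ?submK // -msupp_eq0 msuppMCX.
have hb : (g j - q)@_b = 0.
  rewrite mcoeffB /q -scalerAl mcoeffZ (mulrC 'X_[_]) -[X in (_ * _)@_X](submK le_ij) mcoeffMX.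
  by rewrite /c mulfVK ?subrr.
rewrite lt_neqAle; apply/andP; split.
  apply/eqP => hE; have /eqP : (g j - q)@_(mlead (g j - q)) = 0 by rewrite hE.
  by rewrite mleadc_eq0 => /eqP h0; apply: nJh; rewrite h0; apply: ideal0.
by rewrite (le_trans (mleadB_le _ _)) // leadq joinxx.
Qed.

(** An annihilator that is maximal among those of the nonzero multiples of the
    class of [x] is prime. *)
Lemma Ass_annihilator (A : comNzRingType) (I : set A) x :
  noetherian A -> is_ideal I -> ~ I x ->
  exists P, Ass I P /\ forall u, I (u * x) -> P u.
Proof.
move=> noeA idI nIx.
pose C := [set F | exists y, [/\ ~ I y, F = [set u | I (u * y)]
                                & forall u, I (u * x) -> I (u * y)]].
have idC F : C F -> is_ideal F.
  move=> [y [_ -> _]]; split=> //= [|u v|c u _]; first by rewrite mul0r; apply: ideal0.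
    by rewrite mulrDl; apply: idealD.
  by rewrite -mulrA; apply: idealMl.
have [P [CP maxP]] : exists F, C F /\ forall G, C G -> F `<=` G -> G `<=` F.
  by apply: noeA idC _; exists [set u | I (u * x)], x.
have [y [nIy PE xy]] := CP; exists P; split; last by rewrite PE.
split; last by exists y.
split; [exact: idC|by rewrite PE /= mul1r|move=> a b Pab].
have [Pb|nPb] := pselect (P b); [by right|left].
apply: (maxP [set u | I (u * (b * y))]); last by rewrite /= mulrA; rewrite PE in Pab.
  exists (b * y); split=> // [Iby|u /xy Iuy]; first by apply: nPb; rewrite PE.
  by rewrite mulrCA; apply: idealMl.
by rewrite PE => u /= Iuy; rewrite mulrCA; apply: idealMl.
Qed.

(** * Dual frames over a subring *)

Section Specialization.
Variable R : comNzRingType.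
Implicit Types (F P : set R).

(** Let [N] be the submodule of [R / F] generated by the classes of the [f j].
    If its annihilator lies in the prime [P], then [N] has a nonzero linear
    map to [R / P], here given by the images [c j] of the generators.  The
    induction removes the last generator: either the quotient of [N] by the
    other generators still maps to [R / P], or a scalar outside [P] sends [N]
    into the submodule that the other generators span. *)
Lemma specialization P F r (f : 'I_r -> R) : prime_ideal P -> is_ideal F ->
  (forall a, (forall j, F (a * f j)) -> P a) ->
  exists c : 'I_r -> R, (exists j, ~ P (c j)) /\
    forall a : 'I_r -> R, F (\sum_j a j * f j) -> P (\sum_j a j * c j).
Proof.
move=> prP idF; have [idP P1 primeP] := prP.
elim: r f => [|r IH] f annP; first by case: P1; apply: annP => -[].
have [[a [b [nPa Fab]]]|quot] := pselect (exists a, exists b : 'I_r -> R,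
    ~ P a /\ F (a * f ord_max - \sum_j b j * f (widen_ord (leqnSn r) j))); last first.
  exists (fun j => (j == ord_max)%:R); split; first by exists ord_max; rewrite eqxx.
  move=> a Fa; apply: contrapT => nPa; apply: quot.
  exists (a ord_max), (fun j => - a (widen_ord (leqnSn r) j)); split.
    move=> Pa; apply: nPa; rewrite big_ord_recr /= eqxx mulr1 big1 ?add0r // => j _.
    by rewrite -val_eqE /= ltn_eqF // mulr0.
  have -> : a ord_max * f ord_max -
      \sum_j - a (widen_ord (leqnSn r) j) * f (widen_ord (leqnSn r) j) =
      \sum_j a j * f j.
    by rewrite big_ord_recr /= addrC -sumrN; congr (_ + _);
       apply: eq_bigr => j _; rewrite mulNr opprK.
  exact: Fa.
pose f' j := f (widen_ord (leqnSn r) j).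
have [|c [[j0 nPc] cP]] := IH f'.
  move=> u Fu; suff /primeP[] : P (u * a) by [].
  apply: annP => j; have [->|jr] := eqVneq j ord_max.
    rewrite -mulrA -(subrK (\sum_j b j * f' j) (a * f ord_max)) mulrDr.
    apply: idealD => //; first exact: idealMl.
    rewrite mulr_sumr; apply: ideal_sumr => // l _.
    by rewrite mulrCA; apply: idealMl.
  have jr' : (j < r)%N by rewrite ltn_neqAle -ltnS ltn_ord andbT.
  have -> : j = widen_ord (leqnSn r) (Ordinal jr') by apply: val_inj.
  by rewrite mulrAC; apply: idealMr => //; apply: Fu.
pose c' (j : 'I_r.+1) := oapp (fun l => a * c l) (\sum_l b l * c l) (insub (val j)).
have c'w j : c' (widen_ord (leqnSn r) j) = a * c j.
  by rewrite /c' /= insubT //= => ltj; congr (_ * c _); apply: val_inj.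
have c'max : c' ord_max = \sum_l b l * c l by rewrite /c' /= insubF ?ltnn.
exists c'; split.
  by exists (widen_ord (leqnSn r) j0); rewrite c'w => /primeP[].
move=> d Fd; rewrite big_ord_recr /= c'max.
have -> : \sum_(j < r) d (widen_ord (leqnSn r) j) * c' (widen_ord (leqnSn r) j) +
    d ord_max * (\sum_l b l * c l) =
    \sum_(j < r) (a * d (widen_ord (leqnSn r) j) + d ord_max * b j) * c j.
  rewrite mulr_sumr -big_split /=; apply: eq_bigr => j _.
  by rewrite c'w mulrDl -!mulrA [a * (d _ * _)]mulrCA.
apply: cP.
have -> : \sum_(j < r) (a * d (widen_ord (leqnSn r) j) + d ord_max * b j) * f' j =
    a * (\sum_j d j * f j) - d ord_max * (a * f ord_max - \sum_j b j * f' j).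
  rewrite big_ord_recr /= mulrDr mulrBr opprB addrACA -addrA.
  rewrite [a * (_ * _)]mulrCA subrr addr0 !mulr_sumr -big_split /=.
  by apply: eq_bigr => j _; rewrite mulrDl !mulrA.
by apply: idealB => //; apply: idealMl.
Qed.

End Specialization.

Section DualFrame.
Variables (R A : comNzRingType) (iota : {rmorphism R -> A}).
Implicit Types (F : set R) (G T W : set A).

Definition functional (G : set A) (th : A -> R) : Prop :=
  (forall a x y, th (iota a * x + y) = a * th x + th y) /\
  forall x, G x -> th x = 0.

(** [A / G] behaves as a free [R]-module in which the elements of [T] have
    coordinates that are zero or invertible; for a polynomial ring these
    coordinates are constants.  The [e j] and their dual forms may depend on the
    finite list that they expand, so that no infinite basis has to be built. *)
Definition framed (T G : set A) : Prop :=
  forall gs : seq A, exists r (e : 'I_r -> A) (th : 'I_r -> A -> R),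
    [/\ forall j, functional G (th j),
        forall j l, th j (e l) = (j == l)%:R,
        forall x, x \in gs -> G (x - \sum_j iota (th j x) * e j)
      & forall j x, T x -> th j x = 0 \/ exists b, b * th j x = 1].

Section Functional.
Variables (G : set A) (th : A -> R).
Hypothesis fth : functional G th.

Lemma functional0 : th 0 = 0.
Proof.
have [lin _] := fth; have := lin (-1) 0 0.
by rewrite mulr0 addr0 mulN1r addNr.
Qed.

Lemma functionalMD a x y : th (iota a * x + y) = a * th x + th y.
Proof. by have [lin _] := fth. Qed.

Lemma functionalM a x : th (iota a * x) = a * th x.
Proof. by rewrite -[iota a * x]addr0 functionalMD functional0 addr0. Qed.

Lemma functionalD x y : th (x + y) = th x + th y.
Proof. by have := functionalMD 1 x y; rewrite rmorph1 !mul1r. Qed.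

Lemma functional_sum (I : Type) (s : seq I) (a : I -> R) (e : I -> A) :
  th (\sum_(j <- s) iota (a j) * e j) = \sum_(j <- s) a j * th (e j).
Proof.
elim: s => [|j s IH]; first by rewrite !big_nil functional0.
by rewrite !big_cons functionalMD IH.
Qed.

Lemma functional_mod x y : G (x - y) -> th x = th y.
Proof.
have [_ kil] := fth; move=> Gxy.
by rewrite -{1}(subrK y x) functionalD (kil _ Gxy) add0r.
Qed.

Lemma functional_idext F x : is_ideal F -> is_ideal G ->
  idadd (idext iota F) G x -> F (th x).
Proof.
move=> idF idG [y [z [Fy Gz ->]]]; have [_ kil] := fth.
rewrite functionalD (kil z) // addr0 -(mul1r y).
have idH : is_ideal [set y | forall h, F (th (h * y))].
  split=> //= [h|u v Fu Fv h|c u _ Fu h].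
  - by rewrite mulr0 functional0; apply: ideal0.
  - by rewrite mulrDr functionalD; apply: idealD.
  - by rewrite mulrA.
apply: (idext_sub idH _ Fy) => a Fa h /=; rewrite mulrC functionalM.
exact: idealMr.
Qed.

End Functional.

Section Framed.
Variables (T G : set A).
Hypotheses (idG : is_ideal G) (frG : framed T G).

Lemma framed_idext F x : is_ideal F ->
  (forall th, functional G th -> F (th x)) -> idadd (idext iota F) G x.
Proof.
move=> idF Fx; have [r [e [th [fth _ eP _]]]] := frG [:: x].
have Gx := eP x (mem_head _ _).
rewrite -(subrK (\sum_j iota (th j x) * e j) x) addrC.
exists (\sum_j iota (th j x) * e j), (x - \sum_j iota (th j x) * e j); split=> //.
apply: ideal_sumr => [|j _]; first exact: idext_ideal.
apply: (idealMr _ (idext_ideal iota F)); apply: mem_idext; exact: Fx.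
Qed.

(** [f] is specialized coordinatewise along a nonzero linear map [c] from the
    module spanned by its coordinates in [R / F] to [R / P], where [P] is the
    annihilator of the class of some [x] modulo [I]; multiplication by [x]
    embeds [R / P] in [R / I].  As the coordinates of [f] generate the source of
    [c], the image is nonzero, and by linearity it is killed by all that kills
    [f]. *)
Lemma framed_specialize F I W f : is_ideal F -> is_ideal I ->
  (forall y, ~ F y -> exists P, Ass I P /\ forall a, F (a * y) -> P a) ->
  ~ idadd (idext iota F) G f ->
  (forall w, W w -> idadd (idext iota F) G (w * f)) ->
  exists f', ~ idadd (idext iota I) G f' /\
    forall w, W w -> idadd (idext iota I) G (w * f').
Proof.
move=> idF idI FI nFf WF; have [r [e [th [fth dual eP _]]]] := frG [:: f].
have Gf := eP f (mem_head _ _).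
have [j0 nFj0] : exists j, ~ F (th j f).
  apply/existsNP => Fth; apply: nFf.
  rewrite -(subrK (\sum_j iota (th j f) * e j) f) addrC.
  exists (\sum_j iota (th j f) * e j), (f - \sum_j iota (th j f) * e j); split=> //.
  apply: ideal_sumr => [|j _]; first exact: idext_ideal.
  by apply: (idealMr _ (idext_ideal iota F)); apply: mem_idext.
have [P [[prP [x PE]] annP]] := FI _ nFj0.
have [|c [[j1 nPc] cP]] := specialization (f := fun j => th j f) prP idF.
  by move=> a Fa; apply: annP; apply: Fa.
exists (\sum_j iota (x * c j) * e j); split.
  move=> /(functional_idext (fth j1) idI idG).
  rewrite (functional_sum (fth j1)) (bigD1 j1) //= dual eqxx mulr1 big1 ?addr0.
    by move=> Ix; apply: nPc; rewrite PE /= mulrC.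
  by move=> j j1j; rewrite dual eq_sym (negbTE j1j) mulr0.
move=> w Ww; apply: framed_idext => // th' fth'.
have : P (\sum_j th' (w * e j) * c j).
  apply: cP; have := functional_idext fth' idF idG (WF w Ww).
  have -> : th' (w * f) = th' (\sum_j iota (th j f) * (w * e j)).
    apply: (functional_mod fth').
    have -> : w * f - \sum_j iota (th j f) * (w * e j) =
              w * (f - \sum_j iota (th j f) * e j).
      by rewrite mulrBr mulr_sumr; congr (_ - _); apply: eq_bigr => j _; rewrite mulrCA.
    exact: idealMl.
  rewrite (functional_sum fth').
  by under eq_bigr => j _ do rewrite mulrC.
rewrite PE /= mulr_suml mulr_sumr.
have -> : th' (\sum_j w * (iota (x * c j) * e j)) =
          th' (\sum_j iota (x * c j) * (w * e j)).
  by congr th'; apply: eq_bigr => j _; rewrite mulrCA.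
rewrite (functional_sum fth').
have -> : \sum_j x * c j * th' (w * e j) = \sum_j th' (w * e j) * c j * x.
  by apply: eq_bigr => j _; rewrite -mulrA mulrC [c j * _]mulrC.
by [].
Qed.

(** Some coordinate of [x] lies outside [F], and it inherits the multipliers of
    [x] that come from [R]. *)
Lemma framed_colon F (W : set R) x : is_ideal F ->
  ~ idadd (idext iota F) G x ->
  (forall w, W w -> idadd (idext iota F) G (iota w * x)) ->
  exists y, ~ F y /\ forall w, W w -> F (w * y).
Proof.
move=> idF nFx WF.
have [th [fth nFth]] : exists th, functional G th /\ ~ F (th x).
  apply: contrapT => noth; apply: nFx; apply: framed_idext => // th fth.
  by apply: contrapT => nF; apply: noth; exists th.
exists (th x); split=> // w /WF /(functional_idext fth idF idG).
by rewrite (functionalM fth).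
Qed.

(** The coordinates of [a x] are those of [x] multiplied by [a], so an
    invertible coordinate of [x] would put [a] itself in [F]. *)
Lemma framed_cancel F a x : is_ideal F -> ~ F a -> T x ->
  idadd (idext iota F) G (iota a * x) -> G x.
Proof.
move=> idF nFa Tx Fax; have [r [e [th [fth _ eP constT]]]] := frG [:: x].
have := eP x (mem_head _ _); rewrite big1 ?subr0 // => j _.
have [->|[b bth]] := constT j x Tx; first by rewrite rmorph0 mul0r.
case: nFa; rewrite -(mulr1 a) -bth mulrCA; apply: idealMl => //.
by rewrite -(functionalM (fth j)); apply: functional_idext Fax.
Qed.

Lemma idext_span F x : idext iota F x ->
  exists s : seq (R * A), (forall p, p \in s -> F p.1) /\
    x = \sum_(p <- s) iota p.1 * p.2.
Proof.
pose M := [set x | exists s : seq (R * A), (forall p, p \in s -> F p.1) /\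
    x = \sum_(p <- s) iota p.1 * p.2].
have idM : is_ideal M.
  split=> //.
  - by exists [::]; rewrite big_nil.
  - move=> _ _ [s [Fs ->]] [t [Ft ->]]; exists (s ++ t); rewrite big_cat; split=> //.
    by move=> p; rewrite mem_cat => /orP[/Fs|/Ft].
  - move=> c _ _ [s [Fs ->]]; exists [seq (p.1, c * p.2) | p <- s]; split.
      by move=> _ /mapP[p /Fs Fp ->].
    by rewrite big_map mulr_sumr; apply: eq_bigr => p _; rewrite mulrCA.
apply: (idext_sub idM) => a Fa; exists [:: (a, 1)]; split.
  by move=> p; rewrite inE => /eqP ->.
by rewrite big_seq1 mulr1.
Qed.

(** The intersection of [F A] and [G] is their product because [A / G] is flat
    over [R]: in an expression of [x] with coefficients in [F], the coordinates
    modulo [G] cancel out, and what remains has its second factors in [G]. *)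
Lemma framed_cap F x :
  idext iota F x -> G x -> idmul (idext iota F) G x.
Proof.
move=> /idext_span[s [Fs xE]] Gx.
have [r [e [th [fth _ eP _]]]] := frG [seq p.2 | p <- s].
have th0 j : \sum_(p <- s) p.1 * th j p.2 = 0.
  rewrite -(functional_sum (fth j)) -xE.
  by have [_ kil] := fth j; apply: kil.
have -> : x = \sum_(p <- s) iota p.1 * (p.2 - \sum_j iota (th j p.2) * e j).
  transitivity (x - \sum_j iota (\sum_(p <- s) p.1 * th j p.2) * e j).
    by rewrite big1 ?subr0 // => j _; rewrite th0 rmorph0 mul0r.
  rewrite xE; under [in RHS]eq_bigr => p _ do rewrite mulrBr mulr_sumr.
  rewrite sumrB; congr (_ - _); rewrite exchange_big /=; apply: eq_bigr => j _.
  rewrite raddf_sum /= mulr_suml; apply: eq_bigr => p _.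
  by rewrite rmorphM mulrA.
rewrite big_seq; apply: ideal_sumr => [|p ps]; first exact: idmul_ideal.
apply: mem_idmul; first by apply: mem_idext; apply: Fs.
by apply: eP; apply: map_f.
Qed.

End Framed.
End DualFrame.

(** * Dual systems in vector spaces *)

Section DualSystem.
Variables (K : fieldType) (V : lmodType K).
Implicit Types (S H : set V) (x y : V) (th : V -> K).

Definition subspace S : Prop :=
  S 0 /\ forall a x y, S x -> S y -> S (a *: x + y).

Definition linear_form th : Prop :=
  forall a x y, th (a *: x + y) = a * th x + th y.

Lemma linear_form0 th : linear_form th -> th 0 = 0.
Proof.
move=> lin; have := lin (-1) 0 0.
by rewrite scaler0 addr0 mulN1r addNr.
Qed.

Lemma linear_form_sum th (I : Type) (s : seq I) (a : I -> K) (e : I -> V) :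
  linear_form th ->
  th (\sum_(j <- s) a j *: e j) = \sum_(j <- s) a j * th (e j).
Proof.
move=> lin; elim: s => [|j s IH]; first by rewrite !big_nil linear_form0.
by rewrite !big_cons lin IH.
Qed.

Lemma subspaceZ S a x : subspace S -> S x -> S (a *: x).
Proof. by move=> [S0 lin] Sx; rewrite -[_ *: _]addr0; apply: lin. Qed.

(** A subspace that is maximal among those avoiding [x] is a hyperplane. *)
Lemma separating_form S x : subspace S -> ~ S x ->
  exists th, [/\ linear_form th, forall y, S y -> th y = 0 & th x = 1].
Proof.
move=> subS nSx; pose P := [set B | subspace (B `|` S) /\ ~ (B `|` S) x].
have [B [[subH nHx] maxB]] : exists B, P B /\ forall B', B `<` B' -> ~ P B'.
  apply: Zorn_bigcup => F FP chainF; have [S0 linS] := subS.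
  split; last first.
    by move=> [[B FB Bx]|//]; have [_] := FP _ FB; apply; left.
  split; first by right.
  have inF B y : F B -> (B `|` S) y -> (\bigcup_(X in F) X `|` S) y.
    by move=> FB [By|Sy]; [left; exists B|right].
  move=> a y z [[B FB By]|Sy] [[C FC Cz]|Sz].
  - have [BC|CB] := chainF _ _ FB FC.
      apply: (inF C) => //; have [[_ lin] _] := FP _ FC.
      by apply: lin; left => //; apply: BC.
    apply: (inF B) => //; have [[_ lin] _] := FP _ FB.
    by apply: lin; left => //; apply: CB.
  - apply: (inF B) => //; have [[_ lin] _] := FP _ FB.
    by apply: lin; [left|right].
  - apply: (inF C) => //; have [[_ lin] _] := FP _ FC.
    by apply: lin; [right|left].
  - by right; apply: linS.
set H := B `|` S in subH nHx; have [H0 linH] := subH.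
have hyper y : exists c, H (y - c *: x).
  have [Hy|nHy] := pselect (H y); first by exists 0; rewrite scale0r subr0.
  pose B' := [set z | exists h c, H h /\ z = h + c *: y].
  have sub' : subspace B'.
    split; first by exists 0, 0; rewrite scale0r addr0.
    move=> a _ _ [h [c [Hh ->]]] [h' [c' [Hh' ->]]].
    exists (a *: h + h'), (a * c + c'); split; first exact: linH.
    by rewrite scalerDr scalerDl scalerA addrACA.
  have HB' : H `<=` B' by move=> h Hh; exists h, 0; rewrite scale0r addr0.
  have B'S : B' `|` S = B'.
    by rewrite setUidl // => z Sz; apply: HB'; right.
  have B'x : B' x.
    apply: contrapT => nB'x; apply: (maxB B'); last by split; rewrite B'S.
    rewrite properEneq; split; last by move=> z Bz; apply: HB'; left.
    apply/eqP => BB'; apply: nHy; left; rewrite BB'.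
    by exists 0, 1; rewrite add0r scale1r.
  have [h [c [Hh xE]]] := B'x.
  have c0 : c != 0.
    by apply/eqP => c0; apply: nHx; rewrite xE c0 scale0r addr0.
  exists c^-1; rewrite xE scalerDr scalerA mulVf // scale1r opprD addrCA subrr addr0.
  by rewrite -scaleNr -[_ *: _]addr0; apply: linH.
have [th thP] := choice hyper.
have uniq y c : H (y - c *: x) -> th y = c.
  move=> Hc; apply/eqP; rewrite -subr_eq0; apply/contraT => d0.
  case: nHx; rewrite -[x](scalerK d0); apply: subspaceZ => //.
  have -> : (th y - c) *: x = -1 *: (y - th y *: x) + (y - c *: x).
    by rewrite scalerBl scaleN1r opprB addrA subrK.
  exact: linH.
exists th; split.
- move=> a y z; apply: uniq.
  have -> : a *: y + z - (a * th y + th z) *: x =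
      a *: (y - th y *: x) + (z - th z *: x).
    by rewrite scalerBr scalerDl scalerA opprD addrACA.
  exact: linH.
- by move=> y Sy; apply: uniq; rewrite scale0r subr0; right.
- by apply: uniq; rewrite scale1r subrr.
Qed.

(** A vector of [xs] that is not yet expanded modulo [S] joins the family [e].
    A form [t] that separates it from what is already expanded becomes its dual
    form, and subtracting multiples of [t] makes the older forms vanish on it. *)
Lemma dual_system S (xs : seq V) : subspace S ->
  exists r (e : 'I_r -> V) (th : 'I_r -> V -> K),
    [/\ forall j, e j \in xs,
        forall j, linear_form (th j) /\ forall y, S y -> th j y = 0,
        forall j l, th j (e l) = (j == l)%:R
      & forall y, y \in xs -> S (y - \sum_j th j y *: e j)].
Proof.
move=> subS; have [S0 linS] := subS; elim: xs => [|x xs [r [e [th [exs fth dual eP]]]]].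
  by exists 0%N, (fun=> 0), (fun _ _ => 0); split=> // [[]|[]|[]].
pose H := [set y | S (y - \sum_j th j y *: e j)].
have subH : subspace H.
  split=> [|a y z Hy Hz]; rewrite /H /=.
    by rewrite big1 ?subr0 // => j _; have [lin _] := fth j; rewrite linear_form0 ?scale0r.
  have -> : a *: y + z - \sum_j th j (a *: y + z) *: e j =
      a *: (y - \sum_j th j y *: e j) + (z - \sum_j th j z *: e j).
    rewrite scalerBr addrACA -opprD scaler_sumr -big_split; congr (_ - _).
    by apply: eq_bigr => j _; have [lin _] := fth j; rewrite lin scalerDl scalerA.
  exact: linS.
have [Hx|nHx] := pselect (H x).
  exists r, e, th; split=> // [j|y]; first by rewrite inE exs orbT.
  by rewrite inE => /predU1P[->|/eP].
have [t [lint killt tx]] := separating_form subH nHx.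
have te l : t (e l) = 0.
  apply: killt; rewrite /H /= (bigD1 l) //= dual eqxx scale1r big1 ?addr0 ?subrr // => j jl.
  by rewrite dual (negbTE jl) scale0r.
pose e' (j : 'I_r.+1) := oapp e x (unlift ord0 j).
pose th' (j : 'I_r.+1) y :=
  oapp (fun l => th l y - th l x * t y) (t y) (unlift ord0 j).
have e'0 : e' ord0 = x by rewrite /e' unlift_none.
have e'S l : e' (lift ord0 l) = e l by rewrite /e' liftK.
have th'0 y : th' ord0 y = t y by rewrite /th' unlift_none.
have th'S l y : th' (lift ord0 l) y = th l y - th l x * t y by rewrite /th' liftK.
exists r.+1, e', th'; split.
- move=> j; case: (unliftP ord0 j) => [l|] ->; first by rewrite e'S inE exs orbT.
  by rewrite e'0 mem_head.
- move=> j; case: (unliftP ord0 j) => [l|] ->; last first.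
    split=> [a y z|y Sy]; rewrite !th'0 ?lint //; apply: killt.
    rewrite /H /= big1 ?subr0 // => l _; have [_ kil] := fth l.
    by rewrite kil ?scale0r.
  have [lin kil] := fth l; split=> [a y z|y Sy]; rewrite !th'S.
    by rewrite lin lint mulrDr mulrBr opprD addrACA [th l x * (a * _)]mulrCA.
  rewrite kil // killt ?mulr0 ?subr0 // /H /= big1 ?subr0 // => l' _.
  by have [_ kil'] := fth l'; rewrite kil' ?scale0r.
- move=> j l; case: (unliftP ord0 j) => [j'|] ->; case: (unliftP ord0 l) => [l'|] ->.
  + by rewrite th'S e'S te mulr0 subr0 dual (inj_eq lift_inj).
  + by rewrite th'S e'0 tx mulr1 subrr eq_sym (negbTE (neq_lift _ _)).
  + by rewrite th'0 e'S te (negbTE (neq_lift _ _)).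
  + by rewrite th'0 e'0 tx eqxx.
- move=> y; rewrite big_ord_recl th'0 e'0.
  under eq_bigr => l _ do rewrite th'S e'S.
  rewrite inE => /predU1P[->|/eP Hy].
    rewrite tx scale1r big1 ?addr0 ?subrr // => l _.
    by rewrite mulr1 subrr scale0r.
  rewrite (killt y Hy) scale0r add0r.
  by under eq_bigr => l _ do rewrite mulr0 subr0.
Qed.

End DualSystem.

(** * Blocks of variables *)

Section LinearExtension.
Variables (K : fieldType) (n : nat) (V : lmodType K) (phi : 'X_{1..n} -> V).

Definition linext (p : {mpoly K[n]}) : V := \sum_(M <- msupp p) p@_M *: phi M.

Lemma linextE w p : (msize p <= w)%N ->
  linext p = \sum_(M : 'X_{1..n < w}) p@_M *: phi M.
Proof.
move=> pw; pose S : subFinType _ := 'X_{1..n < w}.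
rewrite /linext (big_mksub S) ?msupp_uniq //=; last first.
  by move=> M /msize_mdeg_lt /leq_trans; apply.
by rewrite big_rmcond //= => M /memN_msupp_eq0 ->; rewrite scale0r.
Qed.

Fact linext_is_linear : linear linext.
Proof.
move=> a p q; pose w := maxn (msize (a *: p + q)) (maxn (msize p) (msize q)).
rewrite !(@linextE w) ?leq_max ?leqnn ?orbT // scaler_sumr -big_split.
by apply: eq_bigr => M _; rewrite mcoeffD mcoeffZ scalerDl scalerA.
Qed.

HB.instance Definition _ :=
  GRing.isLinear.Build K {mpoly K[n]} V _ linext linext_is_linear.

Lemma linextX M : linext 'X_[M] = phi M.
Proof. by rewrite /linext msuppX big_seq1 mcoeffX eqxx scale1r. Qed.

End LinearExtension.

Section Blocks.
Variables (K : fieldType) (k : nat) (m : 'I_k -> nat).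
Local Notation n := (\sum_(i < k) m i)%N.
Local Notation A := {mpoly K[n]}.
Local Notation iota i := (@block_embed K k m i).
Implicit Types (i : 'I_k) (M : 'X_{1..n}).

HB.instance Definition _ i := GRing.RMorphism.copy (@block_embed K k m i)
  (comp_mpoly [tuple 'X_(tagnat.Rank i l) | l < m i]).

Lemma block_embedZ i (c : K) f : iota i (c *: f) = c *: iota i f.
Proof. exact: comp_mpolyZ. Qed.

Definition block_mnm i (u : 'X_{1..m i}) : 'X_{1..n} :=
  (\sum_(l < m i) U_(tagnat.Rank i l) *+ u l)%MM.

Definition restr_mnm i M : 'X_{1..m i} := [multinom M (tagnat.Rank i l) | l < m i].

Definition rest_mnm i M : 'X_{1..n} :=
  [multinom (if tagnat.sig1 l == i then 0%N else M l) | l < n].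

Lemma block_embedX i u : iota i 'X_[u] = 'X_[K, block_mnm u].
Proof.
rewrite /block_embed comp_mpolyX /block_mnm.
rewrite (big_morph (fun M => 'X_[K, M]) (@mpolyXD _ _) (@mpolyX0 _ _)).
by apply: eq_bigr => l _; rewrite tnth_mktuple mpolyXn.
Qed.

Lemma block_mnm_Rank i u l : block_mnm (i := i) u (tagnat.Rank i l) = u l.
Proof.
rewrite /block_mnm mnm_sumE (bigD1 l) //= [X in (_ + X)%N]big1 ?addn0.
  by rewrite mulmnE mnm1E eqxx mul1n.
by move=> l' l'l; rewrite mulmnE mnm1E -val_eqE /= tagnat.eq_Rank eqxx /= val_eqE (negbTE l'l).
Qed.

Lemma block_mnm_other i u (l : 'I_n) : tagnat.sig1 l != i -> block_mnm (i := i) u l = 0%N.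
Proof.
move=> li; rewrite /block_mnm mnm_sumE; apply: big1 => l' _; rewrite mulmnE mnm1E.
by case: (tagnat.Rank i l' =P l) li => // <-; rewrite tagnat.Rank1K eqxx.
Qed.

Lemma RankP i (l : 'I_n) : tagnat.sig1 l = i -> exists l', l = tagnat.Rank i l'.
Proof. by move=> <-; exists (tagnat.sig2 l); rewrite tagnat.sig2K. Qed.

Lemma mnm_split i M : (block_mnm (restr_mnm i M) + rest_mnm i M)%MM = M.
Proof.
apply/mnmP => l; rewrite mnmDE [rest_mnm _ _ _]mnmE; case: eqP => [/RankP[l' ->]|/eqP li].
  by rewrite block_mnm_Rank mnmE addn0.
by rewrite block_mnm_other.
Qed.

Lemma restr_mnmD i M M' : restr_mnm i (M + M') = (restr_mnm i M + restr_mnm i M')%MM.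
Proof. by apply/mnmP => l; rewrite !mnmE. Qed.

Lemma rest_mnmD i M M' : rest_mnm i (M + M') = (rest_mnm i M + rest_mnm i M')%MM.
Proof. by apply/mnmP => l; rewrite !mnmE; case: eqP. Qed.

Lemma restr_block_mnm i u : restr_mnm i (block_mnm u) = u.
Proof. by apply/mnmP => l; rewrite mnmE block_mnm_Rank. Qed.

Lemma rest_block_mnm i (j : 'I_k) u : rest_mnm i (block_mnm (i := j) u) =
  if i == j then 0%MM else block_mnm u.
Proof.
apply/mnmP => l; rewrite mnmE; have [->|ij] := eqVneq i j.
  by rewrite mnm0E; case: eqP => // /eqP; exact: block_mnm_other.
by case: eqP => // li; rewrite block_mnm_other // li.
Qed.

Lemma restr_rest_mnm i M : restr_mnm i (rest_mnm i M) = 0%MM.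
Proof. by apply/mnmP => l; rewrite !mnmE tagnat.Rank1K eqxx. Qed.

Lemma rest_mnmK i M : rest_mnm i (rest_mnm i M) = rest_mnm i M.
Proof. by apply/mnmP => l; rewrite !mnmE; case: eqP. Qed.

Definition free_of i : set A :=
  [set f | forall M, M \in msupp f -> rest_mnm i M = M].

Lemma free_ofD i f g : free_of i f -> free_of i g -> free_of i (f + g).
Proof. by move=> Tf Tg M /msuppD_le; rewrite mem_cat => /orP[/Tf|/Tg]. Qed.

Lemma free_ofZ i c f : free_of i f -> free_of i (c *: f).
Proof. by move=> Tf M /msuppZ_le /Tf. Qed.

Lemma free_of0 i : free_of i 0.
Proof. by move=> M; rewrite msupp0. Qed.

Lemma free_ofX i M : rest_mnm i M = M -> free_of i 'X_[M].
Proof. by move=> TM M'; rewrite msuppX inE => /eqP ->. Qed.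

Lemma free_of1 i : free_of i 1.
Proof. by move=> M; rewrite msupp1 inE => /eqP ->; apply/mnmP => l; rewrite !mnmE; case: eqP. Qed.

Lemma free_ofM i f g : free_of i f -> free_of i g -> free_of i (f * g).
Proof.
move=> Tf Tg M /msuppM_le/allpairsP[[M1 M2] /= [/Tf T1 /Tg T2 ->]].
by rewrite rest_mnmD T1 T2.
Qed.

Lemma free_of_prod i (I : Type) (s : seq I) (P : pred I) (f : I -> A) :
  (forall l, P l -> free_of i (f l)) -> free_of i (\prod_(l <- s | P l) f l).
Proof.
move=> Tf; apply: (big_ind (fun x => free_of i x)) => //; first exact: free_of1.
exact: free_ofM.
Qed.

Lemma free_of_embed i j f : j != i -> free_of i (iota j f).
Proof.
move=> ji; elim/mpolyind: f => [|c u f _ _ Tf]; first by rewrite rmorph0; apply: free_of0.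
rewrite rmorphD /= block_embedZ block_embedX; apply: free_ofD => //.
by apply/free_ofZ/free_ofX; rewrite rest_block_mnm eq_sym (negbTE ji).
Qed.

Section Partial.
Variables (i : 'I_k) (th : A -> K).
Hypothesis lin_th : linear_form th.

(** The base change of the form [th]: if [A] is the tensor product of the
    polynomial ring of the block [i] with that of the other variables, this is
    the identity of the first factor tensored with [th] on the second. *)
Definition partial : A -> {mpoly K[m i]} :=
  linext (fun M => th 'X_[rest_mnm i M] *: 'X_[restr_mnm i M]).

Lemma partialD x y : partial (x + y) = partial x + partial y.
Proof. exact: linearD. Qed.

Lemma partialZ c x : partial (c *: x) = c *: partial x.
Proof. exact: linearZ. Qed.

Lemma partial0 : partial 0 = 0.
Proof. exact: linear0. Qed.

Lemma partialX M : partial 'X_[M] = th 'X_[rest_mnm i M] *: 'X_[restr_mnm i M].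
Proof. exact: linextX. Qed.

Lemma partial_sum (I : Type) (s : seq I) (f : I -> A) :
  partial (\sum_(l <- s) f l) = \sum_(l <- s) partial (f l).
Proof. exact: linear_sum. Qed.

Lemma partialM a x : partial (iota i a * x) = a * partial x.
Proof.
elim/mpolyind: x => [|c M x _ _ IHx]; first by rewrite mulr0 partial0 mulr0.
rewrite mulrDr !partialD mulrDr IHx -scalerAr !partialZ -scalerAr.
congr (_ *: _ + _); move: a {IHx}; apply: mpolyind => [|d u a _ _ IHa].
  by rewrite rmorph0 mul0r partial0 mul0r.
rewrite rmorphD /= !mulrDl partialD IHa block_embedZ -scalerAl partialZ -scalerAl.
rewrite block_embedX -mpolyXD !partialX restr_mnmD rest_mnmD.
by rewrite rest_block_mnm eqxx add0m restr_block_mnm mpolyXD -!scalerAr.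
Qed.

Lemma partial_free x : free_of i x -> partial x = (th x)%:MP.
Proof.
move=> Tx; rewrite {2}[x]mpolyE linear_form_sum // raddf_sum /= /partial /linext.
rewrite big_seq [RHS]big_seq; apply: eq_bigr => M Mx.
have TM := Tx M Mx; rewrite -TM restr_rest_mnm rest_mnmK mpolyX0 TM scalerA.
by rewrite alg_mpolyC.
Qed.

(** An element of [G] is a combination of products of a monomial of the block
    [i] with an element of [G] free of that block, where [partial] is [th]. *)
Lemma partial_kill G : is_ideal G -> G `<=` ideal_gen setT (G `&` free_of i) ->
  (forall y, (G `&` free_of i) y -> th y = 0) -> forall x, G x -> partial x = 0.
Proof.
move=> idG genG kil x /genG Gx.
have idH : is_ideal [set x | forall h, partial (h * x) = 0].
  split=> //= [h|y z Hy Hz h|c y _ Hy h].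
  - by rewrite mulr0 partial0.
  - by rewrite mulrDr partialD Hy Hz addr0.
  - by rewrite mulrA.
rewrite -(mul1r x); apply: (ideal_gen_sub idH) Gx 1 => y [Gy Ty] h /=.
elim/mpolyind: h => [|c M h _ _ IH]; first by rewrite mul0r partial0.
rewrite mulrDl partialD IH addr0 -scalerAl partialZ.
rewrite -[M](mnm_split i) mpolyXD -block_embedX -mulrA partialM partial_free.
  by rewrite kil ?mpolyC0 ?mulr0 ?scaler0 //; split; [exact: idealMl|
     apply: free_ofM => //; apply: free_ofX; exact: rest_mnmK].
by apply: free_ofM => //; apply: free_ofX; exact: rest_mnmK.
Qed.

End Partial.

Definition extended_from_rest i (G : set A) : Prop :=
  is_ideal G /\ G `<=` ideal_gen setT (G `&` free_of i).

(** The monomials outside the block [i] that occur in [gs] are expanded over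
    [K] modulo the part of [G] free of that block; base change turns the dual
    forms over [K] into forms that are linear over the polynomial ring of the
    block. *)
Theorem block_framed i G : extended_from_rest i G ->
  framed (iota i) (free_of i) G.
Proof.
move=> [idG genG] gs.
have subGT : subspace (G `&` free_of i).
  split; first by split; [exact: ideal0|exact: free_of0].
  move=> a x y [Gx Tx] [Gy Ty]; split; last by apply: free_ofD => //; apply: free_ofZ.
  by apply: idealD => //; rewrite -mul_mpolyC; apply: idealMl.
pose xs := [seq 'X_[K, rest_mnm i M] | M <- flatten [seq msupp (g : A) | g <- gs]].
have [r [e [th [exs fth dual eP]]]] := dual_system xs subGT.
have Te j : free_of i (e j).
  have /mapP[M _ ->] := exs j; apply: free_ofX; exact: rest_mnmK.
exists r, e, (fun j => partial i (th j)); split.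
- move=> j; have [lin kil] := fth j; split; last exact: partial_kill.
  by move=> a x y; rewrite partialD partialM.
- move=> j l; have [lin _] := fth j; rewrite partial_free // dual.
  by case: eqP => _; rewrite ?mpolyC1 ?mpolyC0.
- move=> g gs_g.
  have -> : g - \sum_j iota i (partial i (th j) g) * e j =
    \sum_(M <- msupp g) g@_M *: ('X_[M] -
       \sum_j iota i (partial i (th j) 'X_[M]) * e j).
    under [in RHS]eq_bigr => M _ do rewrite scalerBr.
    rewrite sumrB -mpolyE; congr (_ - _).
    under [in RHS]eq_bigr => M _ do rewrite scaler_sumr.
    rewrite exchange_big /=; apply: eq_bigr => j _.
    rewrite {1}[g]mpolyE partial_sum rmorph_sum mulr_suml.
    by apply: eq_bigr => M _; rewrite partialZ /= block_embedZ scalerAl.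
  rewrite big_seq; apply: ideal_sumr => // M Mg.
  rewrite -mul_mpolyC; apply: idealMl => //.
  have -> : 'X_[M] - \sum_j iota i (partial i (th j) 'X_[M]) * e j =
     iota i 'X_[restr_mnm i M] *
       ('X_[rest_mnm i M] - \sum_j th j 'X_[rest_mnm i M] *: e j).
    rewrite mulrBr block_embedX -mpolyXD mnm_split mulr_sumr; congr (_ - _).
    apply: eq_bigr => j _; rewrite partialX block_embedZ block_embedX.
    by rewrite -scalerAl scalerAr.
  apply: idealMl => //; have [] // := eP 'X_[rest_mnm i M].
  apply: map_f; apply/flattenP; exists (msupp g) => //; exact: map_f.
- move=> j x Tx; have [lin _] := fth j; rewrite partial_free //.
  have [->|c0] := eqVneq (th j x) 0; [by left; rewrite mpolyC0|right].
  by exists (th j x)^-1%:MP; rewrite -mpolyCM mulVf ?mpolyC1.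
Qed.

Lemma extended_zero i : extended_from_rest i [set 0].
Proof.
split; first exact: ideal_zero.
by move=> _ ->; apply: ideal0; apply: ideal_gen_ideal.
Qed.

Lemma extended_gen i (S : set A) : S `<=` free_of i ->
  extended_from_rest i (ideal_gen setT S).
Proof.
move=> ST; split; first exact: ideal_gen_ideal.
by apply: ideal_genS => x Sx; split; [exact: sub_ideal_gen|exact: ST].
Qed.

Lemma extended_embed i j F : j != i ->
  extended_from_rest i (idext (iota j) F).
Proof. by move=> ji; apply: extended_gen => _ [a _ <-]; apply: free_of_embed. Qed.

Lemma extended_add i F G : extended_from_rest i F -> extended_from_rest i G ->
  extended_from_rest i (idadd F G).
Proof.
move=> [idF genF] [idG genG]; split; first exact: idadd_ideal.
apply: idadd_sub; first exact: ideal_gen_ideal.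
  apply: subset_trans genF _; apply: ideal_genS => x [Fx Tx]; split=> //.
  exact: sub_idaddl.
apply: subset_trans genG _; apply: ideal_genS => x [Gx Tx]; split=> //.
exact: sub_idaddr.
Qed.

Lemma extended_mul i F G : extended_from_rest i F -> extended_from_rest i G ->
  extended_from_rest i (idmul F G).
Proof.
move=> [idF genF] [idG genG]; split; first exact: idmul_ideal.
apply: idmul_sub; first exact: ideal_gen_ideal.
move=> a b /genF Fa /genG Gb; apply: (ideal_gen_mul _ _ Fa Gb).
  exact: ideal_gen_ideal.
move=> x y [Fx Tx] [Gy Ty]; apply: sub_ideal_gen; split; last exact: free_ofM.
exact: mem_idmul.
Qed.

Lemma extended_pow i F r : extended_from_rest i F ->
  extended_from_rest i (ideal_pow F r).
Proof.
move=> exF; elim: r => [|r IH]; last by rewrite ideal_powS; apply: extended_mul.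
rewrite ideal_pow0; split=> // x _; rewrite -(mulr1 x).
apply: (idealMl x (ideal_gen_ideal _)).
by apply: sub_ideal_gen; split=> //; apply: free_of1.
Qed.

Lemma extended_sum i (E : 'I_k -> set A) :
  (forall j, extended_from_rest i (E j)) -> extended_from_rest i (idsum E).
Proof.
move=> exE; split; first exact: idsum_ideal.
apply: idsum_sub => [|j]; first exact: ideal_gen_ideal.
have [_ genE] := exE j; apply: subset_trans genE _.
by apply: ideal_genS => x [Ex Tx]; split=> //; apply: sub_idsum Ex.
Qed.

End Blocks.

(** * Powers of sums of ideals in disjoint sets of variables *)

Lemma symbolic_powN_Ass (A : idomainType) (I : set A) s y :
  ~ symbolic_pow I s y ->
  exists P, Ass I P /\ forall a, symbolic_pow I s (a * y) -> P a.
Proof.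
move=> nIy; apply: contrapT => noP; apply: nIy; apply/symbolic_powP => P AP.
have prP := Ass_prime AP; apply: contrapT => noU; apply: noP; exists P; split=> // a.
move=> /symbolic_powP /(_ P AP)[v [nPv Ivay]]; apply: contrapT => nPa.
apply: noU; exists (v * a); split; first exact: prime_idealM.
by rewrite -mulrA.
Qed.

(** Converse of [ideal_pow_add_sub], modulo [G].  Elements of
    [F ^ a * Q ^ (n - a)] are subtracted from [f] for increasing [a]; the
    remainder [g] stays in [F ^ a].  The correction [z] that moves it to
    [F ^ (a + 1)] lies both in [F ^ a] and, modulo [G], in [Q ^ (n - a)], hence
    in their product by flatness. *)
Lemma pow_add_cap (R A : comNzRingType) (iota : {rmorphism R -> A})
    (T : set A) (F : set R) (Q G : set A) n f :
  is_ideal F -> is_ideal Q -> is_ideal G ->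
  (forall b, framed iota T (idadd (ideal_pow Q b) G)) ->
  (forall a, (0 < a <= n)%N ->
     idadd (idext iota (ideal_pow F a)) (idadd (ideal_pow Q (n.+1 - a)) G) f) ->
  idadd (ideal_pow (idadd (idext iota F) Q) n) G f.
Proof.
move=> idF idQ idG frQ fP; set S := idadd (idext iota F) Q.
have idFe := idext_ideal iota F.
have idQb b : is_ideal (idadd (ideal_pow Q b) G).
  by apply: idadd_ideal => //; apply: ideal_pow_ideal.
have idS : is_ideal (idadd (ideal_pow S n) G).
  by apply: idadd_ideal => //; apply: ideal_pow_ideal.
have FS b : ideal_pow (idext iota F) b `<=` ideal_pow S b.
  by apply: ideal_pow_monotone; apply: sub_idaddl.
have QS b : ideal_pow Q b `<=` ideal_pow S b.
  by apply: ideal_pow_monotone; apply: sub_idaddr.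
have [n0|n0] := posnP n.
  by apply: sub_idaddl => //; rewrite n0 ideal_pow0.
suff [g [Fg Sg _]] : exists g, [/\ ideal_pow (idext iota F) n g,
    idadd (ideal_pow S n) G (f - g) & idadd (ideal_pow Q 1) G (f - g)].
  rewrite -(subrK g f); apply: idealD => //; apply: sub_idaddl => //; exact: FS.
suff sub a : (a <= n)%N -> exists g, [/\ ideal_pow (idext iota F) a g,
    idadd (ideal_pow S n) G (f - g) & idadd (ideal_pow Q (n.+1 - a)) G (f - g)].
  by have := sub n (leqnn n); rewrite subSnn.
elim: a => [|a IH] an.
  by exists f; rewrite subrr ideal_pow0; split=> //; apply: ideal0.
have [g [Fg Sg Qg]] := IH (ltnW an).
have [g' [y [Fg' Qy fE]]] := fP a.+1 an; rewrite idext_pow in Fg'.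
have Qsub : idadd (ideal_pow Q (n.+1 - a)) G `<=` idadd (ideal_pow Q (n.+1 - a.+1)) G.
  by apply: idaddS => //; apply: ideal_pow_antitone; apply: leq_sub2l.
pose z := g - g'.
have zE : z = y - (f - g) by rewrite /z fE opprB addrCA opprD [y + _]addrCA subrr addr0.
have Fz : ideal_pow (idext iota F) a z.
  apply: (idealB (ideal_pow_ideal _ _) Fg).
  by apply: ideal_pow_antitone Fg'.
have Qz : idadd (ideal_pow Q (n.+1 - a.+1)) G z.
  by rewrite zE; apply: idealB => //; apply: Qsub.
have Sz : idadd (ideal_pow S n) G z.
  have := framed_cap (frQ _) _ Qz.
  move=> /(_ (ideal_pow F a)); rewrite idext_pow => /(_ Fz); apply: idmul_sub => // c d Fc [q [h [Qq Gh ->]]].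
  rewrite mulrDr; apply: idealD => //.
    apply: sub_idaddl => //.
    have -> : n = (a + (n.+1 - a.+1))%N by rewrite subSS subnKC // ltnW.
    by apply: ideal_pow_mul; [apply: FS|apply: QS].
  by apply: sub_idaddr; [exact: ideal_pow_ideal|exact: idealMl].
have fg' : f - g' = (f - g) + z by rewrite /z addrA subrK.
exists g'; rewrite fg'; split=> //; apply: idealD => //; exact: Qsub.
Qed.

Section SumOfBlocks.
Variables (K : fieldType) (k : nat) (m : 'I_k -> nat).
Local Notation A := {mpoly K[\sum_(i < k) m i]}.
Local Notation iota i := (@block_embed K k m i).
Implicit Types (F : forall i : 'I_k, set {mpoly K[m i]}) (E : 'I_k -> set A).

Definition block_ideals F : 'I_k -> set A := fun i => idext (iota i) (F i).

Lemma ideal_sumE F : ideal_sum F = idsum (block_ideals F).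
Proof.
apply/seteqP; split.
  apply: ideal_genS => _ [i _ [a Fa <-]]; exists i => //; exact: mem_idext.
apply: idsum_sub => [|i]; first exact: ideal_gen_ideal.
apply: idext_sub => [|a Fa]; first exact: ideal_gen_ideal.
by apply: sub_ideal_gen; exists i => //; exists a.
Qed.

Lemma block_ideal F i : is_ideal (block_ideals F i).
Proof. exact: idext_ideal. Qed.

Lemma extended_others F i :
  extended_from_rest i (idsum (others (block_ideals F) i)).
Proof.
apply: extended_sum => j; rewrite /others; case: eqP => [_|/eqP ji].
  exact: extended_zero.
exact: extended_embed.
Qed.

Definition tail E d : set A := idsum (fun j => if (j < d)%N then [set 0] else E j).

Definition head E d : set A := idsum (fun j => if (j < d)%N then E j else [set 0]).

Lemma tail0 E : tail E 0 = idsum E.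
Proof. by []. Qed.

Lemma tail_last E : tail E k = [set 0].
Proof. by apply: idsum_zero => j; rewrite ltn_ord. Qed.

Lemma head0 E : head E 0 = [set 0].
Proof. exact: idsum_zero. Qed.

Lemma head_last E : head E k = idsum E.
Proof.
rewrite /head; congr idsum; apply: funext => j; by rewrite ltn_ord.
Qed.

Lemma tail_split E (i : 'I_k) : is_ideal (E i) ->
  tail E i = idadd (E i) (tail E i.+1).
Proof.
move=> idE; rewrite /tail (@idsum_split _ _ _ i) ltnn //; congr (idadd _ (idsum _)).
apply: funext => j; rewrite /others -val_eqE /= ltnS.
by case: ltngtP.
Qed.

Lemma tail_extended F (i : 'I_k) d : (i < d)%N -> extended_from_rest i (tail (block_ideals F) d).
Proof.
move=> id; apply: extended_sum => j; case: ifP => [_|jd]; first exact: extended_zero.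
by apply: extended_embed; apply: contraFneq jd => ->.
Qed.

Lemma head_extended F (i : 'I_k) : extended_from_rest i (head (block_ideals F) i).
Proof.
apply: extended_sum => j; case: ifP => [ji|_]; last exact: extended_zero.
by apply: extended_embed; rewrite neq_ltn ji.
Qed.

Lemma ideal_pow_zero N : (0 < N)%N -> ideal_pow [set 0 : A] N = [set 0].
Proof.
case: N => // N _; rewrite ideal_powS; apply/seteqP; split.
  by apply: idmul_subl; apply: ideal_zero.
by move=> _ ->; apply: ideal0; apply: idmul_ideal.
Qed.

Lemma sum_pred_le (t : 'I_k -> nat) d :
  (\sum_(j < k | (j < d)%N) (t j).-1 <= \sum_(j < k) (t j).-1)%N.
Proof. by rewrite [leqRHS](bigID (fun j : 'I_k => (j < d)%N)) leq_addr. Qed.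

Lemma sum_lt_recr (t : 'I_k -> nat) (i : 'I_k) :
  (\sum_(j < k | (j < i.+1)%N) t j = t i + \sum_(j < k | (j < i)%N) t j)%N.
Proof.
rewrite (bigD1 i) //=; congr (_ + _)%N; apply: eq_bigl => j.
by rewrite ltnS -val_eqE /=; case: ltngtP.
Qed.

Lemma sum_lt0 (t : 'I_k -> nat) : (\sum_(j < k | (j < 0)%N) t j = 0)%N.
Proof. by rewrite big_pred0. Qed.

Lemma sum_lt_last (t : 'I_k -> nat) : (\sum_(j < k | (j < k)%N) t j = \sum_j t j)%N.
Proof. by apply: eq_bigl => j; rewrite ltn_ord. Qed.

(** A product of [s] factors from the blocks has [t i] factors from some
    block [i]. *)
Lemma pow_idsum_sub F (t : 'I_k -> nat) s : (\sum_i (t i).-1 < s)%N ->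
  ideal_pow (idsum (block_ideals F)) s `<=`
  idsum (block_ideals (fun i => ideal_pow (F i) (t i))).
Proof.
move=> ts; pose H := idsum (block_ideals (fun i => ideal_pow (F i) (t i))); rewrite -/H.
have idH : is_ideal H by apply: idsum_ideal.
suff sub d : (d <= k)%N -> ideal_pow (idsum (block_ideals F)) s `<=`
    idadd (ideal_pow (tail (block_ideals F) d)
             (s - \sum_(j < k | (j < d)%N) (t j).-1)) H.
  apply: subset_trans (sub k (leqnn k)) _; rewrite tail_last sum_lt_last.
  rewrite ideal_pow_zero ?subn_gt0 //; apply: (idadd_sub idH) => // _ ->.
  exact: ideal0.
elim: d => [|d IH] dk.
  by rewrite sum_lt0 subn0 tail0; apply: sub_idaddl.
apply: subset_trans (IH (ltnW dk)) _; pose i := Ordinal dk.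
have idR : is_ideal (idadd (ideal_pow (tail (block_ideals F) d.+1)
      (s - \sum_(j < k | (j < d.+1)%N) (t j).-1)) H).
  by apply: idadd_ideal => //; apply: ideal_pow_ideal.
apply: (idadd_sub idR); last by apply: sub_idaddr; apply: ideal_pow_ideal.
rewrite -[d]/(val i) tail_split; last exact: block_ideal.
apply: subset_trans (_ : idadd (ideal_pow (block_ideals F i) (t i)) (ideal_pow
    (tail (block_ideals F) i.+1) (s - \sum_(j < k | (j < i.+1)%N) (t j).-1)) `<=` _).
  apply: ideal_pow_add_sub; [exact: block_ideal|exact: idsum_ideal|].
  rewrite sum_lt_recr; have := leq_ltn_trans (sum_pred_le t i.+1) ts.
  rewrite sum_lt_recr; case: (t i) => [|a] /=; first by rewrite !add0n.
  move=> lt_s; rewrite [(a + _)%N]addnC subnDA addSn ltnS subnKC //.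
  by apply: ltnW; rewrite ltn_subRL addnC.
apply: (idadd_sub idR); last exact: sub_idaddl.
apply: subset_trans (_ : H `<=` _); last first.
  by apply: sub_idaddr; apply: ideal_pow_ideal.
by rewrite -idext_pow; apply: (@sub_idsum _ _ _ i).
Qed.

(** Converse of [pow_idsum_sub]: membership in a power of the sum is detected
    modulo sums of powers, one exponent being split off per block by
    [pow_add_cap]. *)
Lemma pow_idsum_cap F t f : (forall i, is_ideal (F i)) -> (0 < t)%N ->
  ~ ideal_pow (idsum (block_ideals F)) t f ->
  exists a : 'I_k -> nat, [/\ forall i, (0 < a i)%N, (\sum_i (a i).-1 < t)%N
    & ~ idsum (block_ideals (fun i => ideal_pow (F i) (a i))) f].
Proof.
move=> idF t0 nFf.
suff sub d : (d <= k)%N -> exists (a : 'I_k -> nat) N,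
    [/\ forall i, (0 < a i)%N, (0 < N)%N,
       (N + \sum_(j < k | (j < d)%N) (a j).-1 = t)%N
     & ~ idadd (ideal_pow (tail (block_ideals F) d) N)
          (head (block_ideals (fun i => ideal_pow (F i) (a i))) d) f].
  have [a [N [a0 N0 aNt nf]]] := sub k (leqnn k); exists a; split=> //.
    by rewrite -aNt sum_lt_last -[ltnLHS]add0n ltn_add2r.
  rewrite head_last in nf => fa; apply: nf; apply: sub_idaddr => //.
  exact: ideal_pow_ideal.
elim: d => [|d IH] dk.
  exists (fun=> 1%N), t; split=> //; first by rewrite sum_lt0 addn0.
  rewrite tail0 head0; move=> [g [_ [Fg -> fE]]]; apply: nFf.
  by rewrite fE addr0.
have [a [N [a0 N0 aNt nf]]] := IH (ltnW dk); pose i := Ordinal dk.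
pose Ha := block_ideals (fun i => ideal_pow (F i) (a i)); rewrite -/Ha in nf.
have idQ : is_ideal (tail (block_ideals F) i.+1) by apply: idsum_ideal.
have [b [b0N nfb]] : exists b, (0 < b <= N)%N /\
    ~ idadd (idext (iota i) (ideal_pow (F i) b))
        (idadd (ideal_pow (tail (block_ideals F) i.+1) (N.+1 - b)) (head Ha i)) f.
  apply: contrapT => nob; apply: nf; rewrite -[d]/(val i) tail_split; last exact: block_ideal.
  apply: (@pow_add_cap _ _ _ (free_of i)) => //; first exact: idsum_ideal.
    move=> c; apply: block_framed; apply: extended_add; last exact: head_extended.
    by apply: extended_pow; apply: tail_extended.
  by move=> c cN; apply: contrapT => nfc; apply: nob; exists c.
have /andP[b0 bN] := b0N.
pose a' j := if j == i then b else a j.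
have a'i : a' i = b by rewrite /a' eqxx.
have a'lt (j : 'I_k) : (j < i)%N -> a' j = a j by move=> ji; rewrite /a' -val_eqE ltn_eqF.
exists a', (N.+1 - b)%N; split.
- by move=> j; rewrite /a'; case: eqP.
- by rewrite subn_gt0 ltnS.
- rewrite -[d.+1]/(i.+1) sum_lt_recr a'i.
  under eq_bigr => j ji do rewrite a'lt //.
  rewrite -aNt addnA; congr (_ + _)%N.
  by case: (b) b0 bN => // b' _ b'N; rewrite subSS subnK // ltnW.
move=> fa'; apply: nfb.
have idE : is_ideal (idext (iota i) (ideal_pow (F i) b)) by apply: idext_ideal.
have idG : is_ideal (head Ha i) by apply: idsum_ideal.
have idP : is_ideal (idadd (ideal_pow (tail (block_ideals F) i.+1) (N.+1 - b)) (head Ha i)).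
  by apply: idadd_ideal => //; apply: ideal_pow_ideal.
move: fa'; apply: idadd_sub; first exact: idadd_ideal.
  by apply: subset_trans (sub_idaddr idE); apply: sub_idaddl.
apply: idsum_sub => [|j]; first exact: idadd_ideal.
case: ifP => [|_]; last by move=> _ ->; apply: ideal0; apply: idadd_ideal.
rewrite ltnS leq_eqVlt => /predU1P[ji|ji].
  have -> : j = i by apply: val_inj.
  by rewrite /block_ideals a'i; apply: sub_idaddl.
apply: subset_trans (sub_idaddr idE).
apply: subset_trans (_ : head Ha i `<=` _); last first.
  by apply: sub_idaddr; apply: ideal_pow_ideal.
rewrite /block_ideals a'lt //.
by apply: subset_trans (@sub_idsum _ _ _ j); rewrite ji.
Qed.

(** If [f] is outside the sum of the symbolic powers, [framed_specialize]
    replaces that symbolic power by [F i] in one block after another, while the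
    multipliers [W] that send [f] into the ordinary power continue to kill the
    specialized element.  At the end they kill a nonzero class modulo the sum of
    the [F i], so they all lie in one of its associated primes, and [f] is not
    in the symbolic power. *)
Lemma symbolic_pow_idsum_sub F (s : 'I_k -> nat) t :
  (forall i, is_ideal (F i)) -> (\sum_i (s i).-1 < t)%N ->
  symbolic_pow (idsum (block_ideals F)) t `<=`
  idsum (block_ideals (fun i => symbolic_pow (F i) (s i))).
Proof.
move=> idF st f Sf; apply: contrapT => nf.
set B := block_ideals F in Sf *; set Z := block_ideals _ in nf.
pose W := [set w | ideal_pow (idsum B) t (w * f)].
pose M d := idsum (fun j : 'I_k => if (j < d)%N then B j else Z j).
have idB i : is_ideal (B i) by apply: block_ideal.
have idZ i : is_ideal (Z i) by apply: block_ideal.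
suff sub d : (d <= k)%N -> exists g, ~ M d g /\ forall w, W w -> M d (w * g).
  have [g []] := sub k (leqnn k).
  have -> : M k = idsum B.
    by rewrite /M; congr idsum; apply: funext => j; rewrite ltn_ord.
  move=> nBg WB; have [P [AP gP]] :=
    Ass_annihilator (@mpoly_noetherian K _) (idsum_ideal B) nBg.
  have /symbolic_powP /(_ P AP)[u [nPu Wu]] := Sf.
  by apply: nPu; apply: gP; apply: WB.
elim: d => [|d IH] dk.
  exists f; split=> // w Ww; apply: (idsumS _ (pow_idsum_sub st Ww)) => i.
  apply: idextS; exact: ideal_pow_sub_symbolic.
have [g [nMg WM]] := IH (ltnW dk); pose i := Ordinal dk.
pose O := idsum (others (fun j : 'I_k => if (j < d)%N then B j else Z j) i).
have exO : extended_from_rest i O.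
  apply: extended_sum => j; rewrite /others; case: eqP => [_|/eqP ji].
    exact: extended_zero.
  by case: ifP => _; apply: extended_embed.
have [idO _] := exO.
have Md : M d = idadd (Z i) O.
  by rewrite /M (@idsum_split _ _ _ i) /= ltnn.
have MdS : M d.+1 = idadd (B i) O.
  rewrite /M (@idsum_split _ _ _ i) /= ltnSn //; congr (idadd _ (idsum _)).
  apply: funext => j; rewrite /others ltnS leq_eqVlt -val_eqE /=.
  by case: eqP.
rewrite Md in nMg WM; rewrite MdS.
apply: (framed_specialize idO (block_framed exO) _ (idF i) _ nMg WM).
  exact: symbolic_pow_ideal.
exact: symbolic_powN_Ass.
Qed.

Lemma prod_mem_ideal_pow E (s : 'I_k -> nat) (g : 'I_k -> A) (J : seq 'I_k) :
  (forall i, ideal_pow (E i) (s i) (g i)) ->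
  ideal_pow (idsum E) (\sum_(i <- J) s i)%N (\prod_(i <- J) g i).
Proof.
move=> Eg; elim: J => [|i J IH]; first by rewrite !big_nil ideal_pow0.
rewrite !big_cons; apply: ideal_pow_mul => //.
by apply: ideal_pow_monotone (Eg i); apply: sub_idsum.
Qed.

(** If all multipliers of [f i] into the ordinary power fell into an
    associated prime of the sum, a coordinate of the witness of that prime would
    place them in an associated prime of [F i], by [framed_colon]. *)
Lemma prod_mem_symbolic_pow F (s : 'I_k -> nat)
    (f : forall i, {mpoly K[m i]}) : (forall i, is_ideal (F i)) ->
  (forall i, symbolic_pow (F i) (s i) (f i)) ->
  symbolic_pow (idsum (block_ideals F)) (\sum_i s i)%N (\prod_i iota i (f i)).
Proof.
move=> idF Sf; apply/symbolic_powP => P AP.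
have [prP [x PE]] := AP; have [idP P1 primeP] := prP.
have nFx : ~ idsum (block_ideals F) x.
  by move=> Fx; apply: P1; rewrite PE /= mul1r.
have ex_u i : exists u, ~ P (iota i u) /\ ideal_pow (F i) (s i) (u * f i).
  apply: contrapT => no_u; pose O := idsum (others (block_ideals F) i).
  have exO : extended_from_rest i O by apply: extended_others.
  have [idO _] := exO.
  have split_i : idsum (block_ideals F) = idadd (idext (iota i) (F i)) O.
    by apply: idsum_split; apply: block_ideal.
  pose W : set {mpoly K[m i]} := [set w | ideal_pow (F i) (s i) (w * f i)].
  rewrite split_i in nFx.
  have Wx w : W w -> idadd (idext (iota i) (F i)) O (iota i w * x).
    move=> Ww; rewrite -split_i.
    have : P (iota i w) by apply: contrapT => nPw; apply: no_u; exists w.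
    by rewrite PE.
  have [y [nFy WF]] := framed_colon idO (block_framed exO) (idF i) nFx Wx.
  have [Q [AQ yQ]] := Ass_annihilator (@mpoly_noetherian K _) (idF i) nFy.
  have /symbolic_powP /(_ Q AQ)[u [nQu Wu]] := Sf i.
  by apply: nQu; apply: yQ; apply: WF.
have [u uP] : {u : forall i, {mpoly K[m i]} & forall i,
    ~ P (iota i (u i)) /\ ideal_pow (F i) (s i) (u i * f i)}.
  by exists (fun i => sval (cid (ex_u i))) => i; case: cid.
exists (\prod_i iota i (u i)); split.
  apply: (big_ind (fun y => ~ P y)) => // [y z|i _]; first exact: prime_idealM.
  by have [] := uP i.
rewrite -big_split /=.
have -> : \prod_i (iota i (u i) * iota i (f i)) = \prod_i iota i (u i * f i).
  by apply: eq_bigr => i _; rewrite rmorphM.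
apply: prod_mem_ideal_pow => i; rewrite -idext_pow; apply: mem_idext.
by have [] := uP i.
Qed.

(** A tensor product of nonzero classes is nonzero; the factors are cancelled
    one block at a time. *)
Lemma prod_notin_idsum F (f : forall i, {mpoly K[m i]}) :
  (forall i, is_ideal (F i)) -> (forall i, ~ F i (f i)) ->
  ~ idsum (block_ideals F) (\prod_i iota i (f i)).
Proof.
move=> idF nFf Ff.
suff sub d : (d <= k)%N ->
    tail (block_ideals F) d (\prod_(j < k | (d <= j)%N) iota j (f j)).
  have := sub k (leqnn k); rewrite tail_last.
  have -> : \prod_(j < k | (k <= j)%N) iota j (f j) = 1.
    by apply: big_pred0 => j; rewrite leqNgt ltn_ord.
  by apply/eqP; apply: oner_neq0.
elim: d => [|d IH] dk; first by rewrite tail0.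
have := IH (ltnW dk); pose i := Ordinal dk; rewrite -[d]/(val i).
rewrite tail_split; last exact: block_ideal.
have -> : \prod_(j < k | (i <= j)%N) iota j (f j) =
    iota i (f i) * \prod_(j < k | (i <= j)%N && (j != i)) iota j (f j).
  by apply: bigD1 => /=.
have exT : extended_from_rest i (tail (block_ideals F) i.+1) by apply: tail_extended.
have [idT _] := exT.
move=> /(framed_cancel idT (block_framed exT) (idF i) (nFf i)).
have -> : \prod_(j < k | (i <= j)%N && (j != i)) iota j (f j) =
          \prod_(j < k | (d < j)%N) iota j (f j).
  by apply: eq_bigl => j; rewrite -val_eqE /=; case: ltngtP.
apply; apply: free_of_prod => j dj; apply: free_of_embed.
by rewrite -val_eqE /= gtn_eqF.
Qed.

End SumOfBlocks.

(** * The resurgence of a sum *)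

Section Counting.
Variables (k : nat) (g : 'I_k -> nat).
Implicit Types (B : {set 'I_k}).

Lemma card_ord_lt r : (r <= k)%N -> #|[set i : 'I_k | (i < r)%N]%SET| = r.
Proof.
move=> rk; rewrite -sum1_card.
under eq_bigl => i do rewrite inE.
by rewrite (big_ord_narrow rk) sum_nat_const card_ord muln1.
Qed.

Lemma sum_ord_lt_pred r : (r <= k)%N -> (forall i, 0 < g i)%N ->
  (\sum_(i < k | (i < r)%N) g i = \sum_(i < k | (i < r)%N) (g i).-1 + r)%N.
Proof.
move=> rk g0; rewrite -[X in (_ + X)%N](card_ord_lt rk) -sum1_card.
under [X in (_ + X)%N]eq_bigl => i do rewrite inE.
rewrite -big_split; apply: eq_bigr => i _ /=; by rewrite addn1 prednK.
Qed.

Hypothesis g_sorted : forall i j : 'I_k, (i <= j)%N -> (g i <= g j)%N.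

(** The indices of [B] outside the first [#|B|] ones are as many as the first
    ones that [B] misses.  Unless [B] is everything, the value [c] of [g] at the
    index [#|B|] separates both. *)
Lemma sum_first_le B :
  (\sum_(i < k | (i < #|B|)%N) g i <= \sum_(i in B) g i)%N.
Proof.
have Bk : (#|B| <= k)%N by rewrite -[leqRHS]card_ord max_card.
pose C := [set i : 'I_k | (i < #|B|)%N]%SET.
have -> : (\sum_(i < k | (i < #|B|)%N) g i = \sum_(i in C) g i)%N.
  by apply: eq_bigl => i; rewrite inE.
have cardC : #|C| = #|B| by apply: card_ord_lt.
rewrite (big_setID B) [leqRHS](big_setID C) /= finset.setIC leq_add2l.
have cardD : #|C :\: B|%SET = #|B :\: C|%SET.
  apply/eqP; rewrite -(eqn_add2l #|C :&: B|%SET) cardsID cardC.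
  by rewrite finset.setIC cardsID.
have [Blt|] := ltnP #|B| k; last first.
  move=> kB; suff -> : (C :\: B)%SET = finset.set0 by rewrite big_set0.
  apply/eqP; rewrite finset.setD_eq0; have /eqP -> : B == finset.setT.
    by rewrite eqEcard finset.subsetT cardsT card_ord.
  exact: finset.subsetT.
pose c := g (Ordinal Blt).
apply: (@leq_trans (#|C :\: B|%SET * c)).
  rewrite -sum_nat_const; apply: leq_sum => i; rewrite !inE => /andP[_ iB].
  by apply: g_sorted; apply: ltnW.
rewrite cardD -sum_nat_const; apply: leq_sum => i; rewrite !inE -leqNgt => /andP[iB _].
exact: g_sorted.
Qed.

End Counting.

Section Resurgence.
Variables (R : realType) (A : idomainType).
Implicit Types (I : set A) (s t : nat).

Lemma resurgence_ge I s t : (0 < s)%N -> (0 < t)%N ->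
  ~ symbolic_pow I s `<=` ideal_pow I t ->
  ((s%:R / t%:R)%:E <= resurgence R I)%E.
Proof. by move=> s0 t0 nst; apply: ereal_sup_ubound; exists s, t. Qed.

Lemma resurgence_le I x :
  (forall s t, (0 < s)%N -> (0 < t)%N -> ~ symbolic_pow I s `<=` ideal_pow I t ->
     ((s%:R / t%:R)%:E <= x)%E) ->
  (resurgence R I <= x)%E.
Proof.
by move=> Ix; apply: ge_ereal_sup => _ [s [t [s0 t0 nst ->]]]; apply: Ix.
Qed.

Lemma symbolic_pow_succ_sub I t : resurgence R I = 1%E -> (0 < t)%N ->
  symbolic_pow I t.+1 `<=` ideal_pow I t.
Proof.
move=> I1 t0; apply: contrapT => nst.
have := resurgence_ge (ltn0Sn t) t0 nst.
by rewrite I1 lee_fin ler_pdivrMr ?ltr0n // mul1r ler_nat ltnn.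
Qed.

End Resurgence.

Section Containment.
Variables (K : fieldType) (k : nat) (m : 'I_k -> nat).
Implicit Types (F : forall i : 'I_k, set {mpoly K[m i]}).

(** The product of witnesses from the blocks is a witness for the sum. *)
Lemma noncontainment_sum F (s a : 'I_k -> nat) :
  (forall i, is_ideal (F i)) ->
  (forall i, ~ symbolic_pow (F i) (s i) `<=` ideal_pow (F i) (a i)) ->
  ~ symbolic_pow (ideal_sum F) (\sum_i s i)%N `<=`
    ideal_pow (ideal_sum F) (\sum_i (a i).-1).+1.
Proof.
move=> idF nsa; rewrite ideal_sumE => sub.
have ex_f i : exists f, symbolic_pow (F i) (s i) f /\ ~ ideal_pow (F i) (a i) f.
  apply: contrapT => nof; apply: (nsa i) => f Sf; apply: contrapT => nPf.
  by apply: nof; exists f.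
have [f fP] : {f : forall i, {mpoly K[m i]} & forall i,
    symbolic_pow (F i) (s i) (f i) /\ ~ ideal_pow (F i) (a i) (f i)}.
  by exists (fun i => sval (cid (ex_f i))) => i; case: cid.
have Sf := prod_mem_symbolic_pow idF (fun i => (fP i).1).
apply: (@prod_notin_idsum _ _ _ (fun i => ideal_pow (F i) (a i)) f).
- by move=> i; apply: ideal_pow_ideal.
- by move=> i; have [] := fP i.
- by apply: (pow_idsum_sub (ltnSn _)); apply: sub.
Qed.

(** The exponents [a] describe a sum of ordinary powers that misses some [f] of
    the symbolic power.  [B] collects the blocks with [p i <= a i]: there the
    symbolic power of exponent [a i + 1] is inside the ordinary power of exponent
    [a i], and elsewhere the two powers of exponent [a i] agree.  If [s] were
    larger than the bound, [symbolic_pow_idsum_sub] would put [f] in that sum. *)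
Lemma noncontainment_sum_bound F (p : 'I_k -> nat) s t :
  (forall i, is_ideal (F i)) ->
  (forall i q, (0 < q < p i)%N -> symbolic_pow (F i) q = ideal_pow (F i) q) ->
  (forall i q, (0 < q)%N -> symbolic_pow (F i) q.+1 `<=` ideal_pow (F i) q) ->
  (0 < t)%N -> ~ symbolic_pow (ideal_sum F) s `<=` ideal_pow (ideal_sum F) t ->
  exists B : {set 'I_k}, (s < t + #|B|)%N /\ (\sum_(i in B) (p i).-1 < t)%N.
Proof.
move=> idF Fp Fsucc t0; rewrite ideal_sumE => nst.
have [f [Sf nPf]] : exists f, symbolic_pow (idsum (block_ideals F)) s f /\
    ~ ideal_pow (idsum (block_ideals F)) t f.
  apply: contrapT => nof; apply: nst => f Sf; apply: contrapT => nPf.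
  by apply: nof; exists f.
have [a [a0 at_ nf]] := pow_idsum_cap idF t0 nPf.
pose B := [set i | (p i <= a i)%N]%SET.
pose b i := (a i + (i \in B))%N.
have sub_b i : symbolic_pow (F i) (b i) `<=` ideal_pow (F i) (a i).
  rewrite /b inE; case: leqP => [_|ap]; first by rewrite addn1; apply: Fsucc.
  by rewrite addn0 Fp // a0.
have sumb : (\sum_i (b i).-1 = \sum_i (a i).-1 + #|B|)%N.
  rewrite -sum1_card [X in (_ + X)%N]big_mkcond -big_split /=.
  apply: eq_bigr => i _; rewrite /b; case: (i \in B); last by rewrite !addn0.
  by rewrite addn1 /= addn1 prednK.
exists B; split.
  suff : (s <= \sum_i (b i).-1)%N.
    by move=> /leq_ltn_trans; apply; rewrite sumb ltn_add2r.
  rewrite leqNgt; apply/negP => bs; apply: nf.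
  have := symbolic_pow_idsum_sub idF bs Sf; apply: idsumS => i.
  by apply: idextS; apply: sub_b.
apply: leq_ltn_trans at_; rewrite [leqRHS](bigID (mem B)) /=.
apply: leq_trans (leq_addr _ _); apply: leq_sum => i; rewrite inE => pa.
by rewrite -!subn1 leq_sub2r.
Qed.

End Containment.

Theorem theorem3p9 (R : realType) (K : fieldType) (k : nat) (hk : (2 <= k)%N)
    (m : 'I_k -> nat) (I : forall i : 'I_k, set {mpoly K[m i]})
    (I_ideal : forall i, is_ideal (I i))
    (I_homog : forall i, homogeneous_ideal (I i))
    (I_nonzero : forall i, I i <> [set 0])
    (I_proper : forall i, I i <> setT)
    (p : 'I_k -> nat)
    (p_least : forall i, first_symbolic_gap (I i) (p i))
    (p_sorted : forall i j : 'I_k, (i <= j)%N -> (p i <= p j)%N)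
    (I_resurgence : forall i, resurgence R (I i) = 1%E) :
  resurgence R (ideal_sum I) =
  \big[Order.max/-oo%E]_(2 <= r < k.+1)
    ((\sum_(i < k | (i < r)%N) (p i)%:R) /
     (\sum_(i < k | (i < r)%N) (p i)%:R - r%:R + 1))%:E.
Proof.
have p_gt0 i : (0 < p i)%N by have [] := p_least i.
pose N r := (\sum_(i < k | (i < r)%N) (p i).-1)%N.
have termE r : (r <= k)%N -> (\sum_(i < k | (i < r)%N) (p i)%:R) /
    (\sum_(i < k | (i < r)%N) (p i)%:R - r%:R + 1) = (N r + r)%:R / (N r).+1%:R :> R.
  move=> rk; rewrite -natr_sum sum_ord_lt_pred // -/(N r).
  by rewrite {2}natrD addrK natr1.
have range_mem r : (1 < r <= k)%N -> r \in index_iota 2 k.+1.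
  by rewrite mem_index_iota ltnS.
apply/eqP; rewrite eq_le; apply/andP; split.
  apply: resurgence_le => s t s0 t0 nst.
  have [||B [sB NB]] := noncontainment_sum_bound (p := p) I_ideal _ _ t0 nst.
  - by move=> i; have [] := p_least i.
  - by move=> i q; apply: symbolic_pow_succ_sub.
  have {NB}NB : (N #|B| < t)%N.
    apply: leq_ltn_trans NB; apply: sum_first_le => i j ij.
    by rewrite -!subn1 leq_sub2r // p_sorted.
  have Bk : (#|B| <= k)%N by rewrite -[leqRHS]card_ord max_card.
  (* With at most one exceptional block the ratio is at most 1, which is below
     the term of index 2. *)
  have [r [r2 rk le_st]] : exists r, [/\ (1 < r)%N, (r <= k)%N &
      (s * (N r).+1 <= (N r + r) * t)%N].
    have [B2|B1] := ltnP 1 #|B|; last first.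
      exists 2%N; split=> //; rewrite mulnC leq_mul ?addn2 //.
      by rewrite -ltnS (leq_trans sB) // -addn1 leq_add2l.
    exists #|B|; split=> //.
    have [d tE] : exists d, t = ((N #|B|).+1 + d)%N.
      by exists (t - (N #|B|).+1)%N; rewrite subnKC.
    have sle : (s <= N #|B| + #|B| + d)%N by rewrite -ltnS (leq_trans sB) // tE !addSn addnAC.
    apply: leq_trans (leq_mul sle (leqnn _)) _; rewrite tE mulnDl mulnDr leq_add2l mulnC.
    by rewrite leq_mul // -addn1 leq_add2l ltnW.
  have nz j : (0 < j)%N -> 0 < j%:R :> R by rewrite ltr0n.
  apply: bigmax_sup_seq (range_mem r _) isT _; first by rewrite r2.
  rewrite lee_fin termE // ler_pdivrMr ?nz // mulrAC ler_pdivlMr ?nz //.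
  by rewrite -!natrM ler_nat.
rewrite big_seq; apply: bigmax_le; first exact: leNye.
move=> r; rewrite mem_index_iota ltnS => /andP[r2 rk].
(* The first [r] blocks contribute their first gap; the others contribute the
   element 1, which is in the symbolic power of exponent 0 but not in [I i]. *)
pose s (i : 'I_k) := if (i < r)%N then p i else 0%N.
pose a (i : 'I_k) := if (i < r)%N then p i else 1%N.
have sumsE : (\sum_i s i = N r + r)%N.
  by rewrite -sum_ord_lt_pred // [RHS]big_mkcond.
have sumaE : (\sum_i (a i).-1 = N r)%N.
  by rewrite /N [RHS]big_mkcond; apply: eq_bigr => i _; rewrite /a; case: ifP.
rewrite termE // -sumsE -sumaE; apply: resurgence_ge => //.
  by rewrite sumsE addn_gt0 (ltnW r2) orbT.
apply: noncontainment_sum => // i; rewrite /s /a; case: ifP => _ sub.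
  have [_ neq _] := p_least i; apply: neq; apply/seteqP; split=> //.
  exact: ideal_pow_sub_symbolic.
apply: (I_proper i); apply: ideal_eqT => //.
rewrite -[I i]ideal_pow1 //; apply: sub; apply: ideal_pow_sub_symbolic.
by rewrite ideal_pow0.
Qed.
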